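(* The following statements hold almost surely when $X_1,\dots,X_n$ are i.i.d. from a density on $\mathbb{R}$. (A) For $n\ge 2$ the (unconstrained) nonparametric maximum likelihood estimator $\widehat\varphi_n$ exists and is unique. It is linear on all intervals $[X_{(j)},X_{(j+1)}]$, $j=1,\dots,n-1$. Moreover, $\widehat\varphi_n=-\infty$ and $\widehat f_n=0$ on $\mathbb{R}\setminus[X_{(1)},X_{(n)}]$. (B) For $N\ge 2$ the mode-constrained maximum likelihood estimator $\widehat\varphi_n^0$ exists and is unique. It is piecewise linear with knots at the $Z_i$'s and domain $[Z_1,Z_N]$. If $m$ is not a data point, then at least one of $(\widehat\varphi_n^0)'(m+)$ or $(\widehat\varphi_n^0)'(m-)$ is $0$. (C) The symmetry-constrained maximum likelihood estimator $\widehat\psi_n^0\in\mathcal{SC}_0$ exists for $n\ge 1$ and is unique. It is piecewise linear with knots contained in the set of $2n+1$ points $$-|X|_{(n)},\dots,-|X|_{(1)},\,0,\,|X|_{(1)},\dots,|X|_{(n)},$$ and is $-\infty$ for $x\notin[-|X|_{(n)},|X|_{(n)}]$. Furthermore, $(\widehat\psi_n^0)'(0\pm)=0$.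
   Context: Classes: $\mathcal{C}$ is the class of concave, closed, proper functions $\varphi:\mathbb{R}\to[-\infty,\infty)$. For a fixed $m\in\mathbb{R}$, $\mathcal{C}_m=\{\varphi\in\mathcal{C}:\varphi(m)\ge\varphi(x)\text{ for all }x\in\mathbb{R}\}$. $\mathcal{SC}_0=\{\varphi\in\mathcal{C}_0:\varphi(-x)=\varphi(x)\text{ for all }x\in\mathbb{R}\}$. The domain of $\varphi\in\mathcal{C}$ is $\{x:\varphi(x)>-\infty\}$. Estimators: the criterion function is $$\Psi_n(\varphi)=\frac1n\sum_{i=1}^n\varphi(X_i)-\int_{\mathbb{R}}e^{\varphi(x)}\,dx ,$$ and $\widehat\varphi_n=\operatorname{argmax}_{\varphi\in\mathcal{C}}\Psi_n(\varphi)$, $\widehat f_n=e^{\widehat\varphi_n}$, $\widehat\varphi_n^0=\operatorname{argmax}_{\varphi\in\mathcal{C}_m}\Psi_n(\varphi)$, $\widehat\psi_n^0=\operatorname{argmax}_{\psi\in\mathcal{SC}_0}\Psi_n(\psi)$. Order statistics: $X_{(1)}<\dots<X_{(n)}$ are the order statistics of the $X_i$ and $|X|_{(1)}<\dots<|X|_{(n)}$ those of $|X_1|,\dots,|X_n|$. Mode-augmented data $Z_1,\dots,Z_N$: if $m=X_{(k)}$ for some $k\in\{1,\dots,n\}$, then $N=n$ and $Z_j=X_{(j)}$ for $j=1,\dots,n$. If $m\in(X_{(k-1)},X_{(k)})$ for some $k\in\{1,\dots,n+1\}$ (with $X_{(0)}=-\infty$, $X_{(n+1)}=+\infty$), then $N=n+1$,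 $Z_i=X_{(i)}$ for $i\le k-1$, $Z_k=m$, and $Z_i=X_{(i-1)}$ for $i=k+1,\dots,n+1$. The knots of a continuous piecewise linear function on $[A,B]$ are the points of $(A,B)$ where its left and right derivatives differ, together with $A$ and $B$. $g'(x+)$ and $g'(x-)$ denote right and left derivatives of $g$ at $x$, and $g'(x\pm)=0$ means that both vanish. *)

(* Defs.v *)
From HB Require Import structures.
From mathcomp Require Import all_boot all_order all_algebra.
From mathcomp Require Import all_classical all_reals all_analysis.

Set Implicit Arguments.
Unset Strict Implicit.
Unset Printing Implicit Defensive.

Import Order.TTheory GRing.Theory Num.Theory.
Import numFieldNormedType.Exports.

Local Open Scope classical_set_scope.
Local Open Scope ring_scope.

Section Classes.
Context {R : realType}.
Implicit Types (phi : R -> \bar R) (m : R).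
Local Open Scope ereal_scope.

(* Since phi < +oo in the classes below, no +oo - oo occurs here, and
   0 * -oo = 0 makes the cases t = 0 and t = 1 trivial. *)
Definition concave phi :=
  forall (x y t : R), (0 <= t <= 1)%R ->
    t%:E * phi x + (1 - t)%:E * phi y <= phi (t * x + (1 - t) * y)%R.

(* A proper concave function is closed iff it is upper semicontinuous. *)
Definition closed_concave phi := lower_semicontinuous (fun x => - phi x).

Definition edom phi : set R := [set x | -oo < phi x].

Definition classC : set (R -> \bar R) :=
  [set phi | [/\ forall x, phi x < +oo,
                 edom phi !=set0,
                 concave phi &
                 closed_concave phi]].

Definition classCm m : set (R -> \bar R) :=
  [set phi | classC phi /\ forall x, phi x <= phi m].

Definition classSC0 : set (R -> \bar R) :=
  [set phi | classCm 0%R phi /\ forall x, phi (- x)%R = phi x].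

(* On classC the sum is < +oo and the integral is >= 0, so the difference is
   never of the form +oo - +oo; it is -oo as soon as the integral is +oo. *)
Definition Psi n (x : 'I_n -> R) phi : \bar R :=
  (n%:R^-1)%:E * (\sum_(i < n) phi (x i))
  - \int[lebesgue_measure]_(t in setT) expeR (phi t).

Definition is_argmax (F : set (R -> \bar R)) (J : (R -> \bar R) -> \bar R) phi :=
  F phi /\ forall chi, F chi -> J chi <= J phi.

Definition linear_on phi (a b : R) :=
  exists c d : R, forall x, (a <= x <= b)%R -> phi x = (c * x + d)%:E.

(* Adjacent closed pieces share an endpoint, hence phi is finite and
   continuous on [A, B]. *)
Definition continuous_pl phi (A B : R) :=
  (A < B)%R /\
  exists s : seq R, [/\ path <%R A s, last A s = B &
    forall i, (i < size s)%N -> linear_on phi (nth A (A :: s) i) (nth A s i)].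

(* One-sided derivatives in \bar R; where phi jumps to -oo on the relevant side
   of a point of its domain, the derivative is infinite, in particular
   different from 0. *)
Definition is_right_derivative phi (x : R) (l : \bar R) :=
  phi x \is a fin_num /\
  (phi (x + h)%R - phi x) * (h^-1)%:E @[h --> (0%R : R)^'+] --> l.

Definition is_left_derivative phi (x : R) (l : \bar R) :=
  phi x \is a fin_num /\
  (phi (x + h)%R - phi x) * (h^-1)%:E @[h --> (0%R : R)^'-] --> l.

Definition knots phi (A B : R) : set R :=
  [set x | x = A \/ x = B \/
    ((A < x < B)%R /\ exists l r, [/\ is_left_derivative phi x l,
                                      is_right_derivative phi x r & l <> r])].

End Classes.

Section OrderStatistics.
Context {R : realType}.

Definition ostats n (x : 'I_n -> R) : seq R := sort <=%R (codom x).

(* 1-based indexing. *)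
Definition item (s : seq R) (j : nat) : R := nth 0 s j.-1.

Definition mode_augmented (m : R) n (x : 'I_n -> R) : seq R :=
  let s := ostats x in
  let k := count (fun y => y < m) s in
  if m \in s then s else take k s ++ m :: drop k s.

Definition abs_sample n (x : 'I_n -> R) : 'I_n -> R := fun i => `|x i|.

Definition signed_ostats n (x : 'I_n -> R) : seq R :=
  let s := ostats (abs_sample x) in
  map -%R (rev s) ++ 0 :: s.

End OrderStatistics.

Section Sampling.
Context d (T : measurableType d) (R : realType) (P : probability T R).
Local Open Scope ereal_scope.

Definition is_density (f : R -> R) :=
  [/\ measurable_fun setT f, forall x, (0 <= f x)%R &
      \int[lebesgue_measure]_(x in setT) (f x)%:E = 1].

Definition has_density (X : {RV P >-> R}) (f : R -> R) :=
  forall A : set R, measurable A ->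
    distribution P X A = \int[lebesgue_measure]_(x in A) (f x)%:E.

(* Product rule over all Borel sets; taking some B i := setT gives the rule for
   every subfamily. *)
Definition mutually_independent n (X : 'I_n -> {RV P >-> R}) :=
  forall B : 'I_n -> set R, (forall i, measurable (B i)) ->
    P (\bigcap_(i in setT) (X i @^-1` B i))
    = \prod_(i < n) P (X i @^-1` B i).

Definition iid_density n (X : 'I_n -> {RV P >-> R}) (f : R -> R) :=
  [/\ is_density f, mutually_independent X & forall i, has_density (X i) f].

End Sampling.

(* Main.v *)
Require Import Defs.
From HB Require Import structures.
From mathcomp Require Import all_boot all_order all_algebra.
From mathcomp Require Import all_classical all_reals all_analysis.
From mathcomp Require Import measurable_realfun ring lra.

Set Implicit Arguments.
Unset Strict Implicit.
Unset Printing Implicit Defensive.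

Import Order.TTheory GRing.Theory Num.Theory.
Import numFieldNormedType.Exports.

Local Open Scope classical_set_scope.
Local Open Scope ring_scope.

(** Every one of the three maximisation problems lives on a class of the form
    order_class rel: the functions phi of classC such that phi a <= phi b
    whenever rel a b.  The relation is empty for classC, it is b = m for
    classCm m, and it is (b = 0 or b = - a) for classSC0.  The proof is carried
    out once, for such a class and a finite list s of candidate knots with
    extreme points A < B that contains the observations.

    Reduction to finite dimension.  Let phi be in the class and let v be its
    values on s.  The piecewise linear interpolant interp s A B v, which is -oo
    outside [A, B], lies below phi by concavity and coincides with phi at the
    observations, so it has the same likelihood term and at most the same mass.
    It is again in the class.  So the criterion may be maximised over the
    vectors v of concave data that satisfy the order constraints (admissible).

    Existence.  On those vectors the criterion, score, is continuous, because
    adding a constant d to a log-density multiplies its mass by e^d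
    (mass_interp_near).  It is also coercive: if the largest value of v is u
    above a fixed score level, then no value of v is more than n u below that
    largest value, and concavity makes the mass at least a constant times
    e^u / (1 + n u), whereas the mass of a competitive v is at most u
    (mass_interp_ge, exp_beats_square, coercive).  A compact box then contains
    a maximiser (score_max).

    Uniqueness.  A maximiser phi and its interpolant have the same finite mass,
    so they touch in every interval, and by concavity they are equal
    (argmax_interp).  For two maximisers that are interpolants, the strict
    convexity of exp forces the midpoint inequality to be an equality somewhere
    in every subinterval of [A, B], so the two interpolants touch in every such
    subinterval and agree on the knots (argmax_uniq).

    Shape.  Linearity between knots, the domain and the location of the knots
    are properties of interpolants.  The vanishing derivatives come from
    uniqueness: truncating a maximiser at its largest value over the sample
    stays in the class and does not decrease the criterion, so a maximiser
    attains its maximum at an observation (argmax_le_data).  If the mode m (or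
    0) is not an observation, concavity makes the maximiser constant between m
    and that observation.

    Probability enters only to exclude ties: since the observations have
    densities and are independent, almost surely they are pairwise distinct and
    none of them is 0 (ae_neq_independent, ae_neq_cst). *)

(** * Piecewise linear interpolation of concave data *)

Section Interpolation.
Context {R : realType}.
Implicit Types (s : seq R) (v : R -> R) (p q t z : R) (phi : R -> \bar R).

Lemma seq_maxP (P : pred R) s z0 : z0 \in s -> P z0 ->
  exists p, [/\ p \in s, P p & forall z, z \in s -> P z -> z <= p].
Proof.
elim: s z0 => // a s IH z0; case: (boolP (has P s)) => [/hasP[z1 z1s Pz1] _ _|].
  have [p [ps Pp pmax]] := IH _ z1s Pz1.
  have [Pa|nPa] := boolP (P a); last first.
    exists p; split; rewrite ?inE ?ps ?orbT// => z.
    by rewrite inE => /predU1P[-> Pz|/pmax//]; rewrite Pz in nPa.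
  have [ap|pa] := leP a p.
    by exists p; split; rewrite ?inE ?ps ?orbT// => z /predU1P[->//|/pmax].
  exists a; split; rewrite ?inE ?eqxx// => z /predU1P[->//|zs Pz].
  exact: le_trans (pmax _ zs Pz) (ltW pa).
move=> /hasPn nP; rewrite inE => /predU1P[-> Pa|/nP/negP//].
exists a; split; rewrite ?inE ?eqxx// => z /predU1P[->//|/nP/negP//].
Qed.

Lemma seq_minP (P : pred R) s z0 : z0 \in s -> P z0 ->
  exists p, [/\ p \in s, P p & forall z, z \in s -> P z -> p <= z].
Proof.
move=> z0s Pz0.
have z0Ns : - z0 \in map -%R s by rewrite mem_map//; exact: oppr_inj.
have [|p [ps Pp pmax]] := @seq_maxP (fun z => P (- z)) _ _ z0Ns.
  by rewrite opprK.
exists (- p); split => //.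
  by rewrite -[p]opprK mem_map in ps => //; exact: oppr_inj.
move=> z zs Pz; rewrite lerNl; apply: pmax; last by rewrite opprK.
by rewrite mem_map//; exact: oppr_inj.
Qed.

(** Only the set of members of s matters, so that a sample with ties can serve
    as the list of knots as soon as its extreme points differ. *)
Definition spans s (A B : R) :=
  [/\ A \in s, B \in s, A < B & forall z, z \in s -> A <= z <= B].

Definition adjacent s p q :=
  [/\ p \in s, q \in s, p < q & forall z, z \in s -> z <= p \/ q <= z].

(** As a function of t on the whole line: outside [p, q] this is the
    extrapolation, which bounds a concave function from above. *)
Definition chord v p q t := v p + (v q - v p) / (q - p) * (t - p).

Lemma chordl v p q : chord v p q p = v p.
Proof. by rewrite /chord subrr mulr0 addr0. Qed.

Lemma chordr v p q : p < q -> chord v p q q = v q.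
Proof.
by move=> pq; rewrite /chord divfK ?subr_eq0 ?gt_eqF// addrC subrK.
Qed.

Lemma chord_conv p q t : p < q -> p <= t <= q ->
  exists2 l, 0 <= l <= 1 & t = l * p + (1 - l) * q /\
    forall v, chord v p q t = l * v p + (1 - l) * v q.
Proof.
move=> pq /andP[pt tq]; have qp0 : q - p != 0 by rewrite subr_eq0 gt_eqF.
exists ((q - t) / (q - p)).
  by rewrite ler_pdivlMr ?ler_pdivrMr ?subr_gt0//; apply/andP; split; lra.
by split; [field|move=> v; rewrite /chord; field].
Qed.

Lemma chord_affine (c d : R) p q t : p < q ->
  chord (fun u => c * u + d) p q t = c * t + d.
Proof.
by move=> pq; rewrite /chord; field; rewrite subr_eq0 gt_eqF.
Qed.

Lemma le_chord v w p q t : p < q -> p <= t <= q ->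
  v p <= w p -> v q <= w q -> chord v p q t <= chord w p q t.
Proof.
move=> pq ptq vwp vwq; have [l /andP[l0 l1] [_ H]] := chord_conv pq ptq.
by rewrite !H lerD// ler_wpM2l// subr_ge0.
Qed.

Lemma chord_slope v p q t : chord v p q t =
  (v q - v p) / (q - p) * t + (v p - (v q - v p) / (q - p) * p).
Proof. rewrite /chord; ring. Qed.

Lemma adjacent_around s A B t : spans s A B -> A <= t <= B ->
  exists p q, adjacent s p q /\ p <= t <= q.
Proof.
move=> [As Bs AB sAB] /andP[At]; rewrite le_eqVlt => /predU1P[->|tB].
  have [p [ps pB pmax]] := @seq_maxP (fun z => z < B) s A As AB.
  exists p, B; split; last by rewrite (ltW pB)/=.
  split => // z zs; have [_] := andP (sAB _ zs).
  by rewrite le_eqVlt => /predU1P[->|/(pmax _ zs)]; [right|left].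
have [p [ps pt pmax]] := @seq_maxP (fun z => z <= t) s A As At.
have [q [qs tq qmin]] := @seq_minP (fun z => t < z) s B Bs tB.
exists p, q; split; last by rewrite pt/= ltW.
split => //; first exact: le_lt_trans pt tq.
by move=> z zs; case: (leP z t) => [/(pmax _ zs)|/(qmin _ zs)]; [left|right].
Qed.

Lemma adjacent_between s A B a b : spans s A B -> A <= a -> a < b -> b <= B ->
  (forall z, z \in s -> ~~ (a < z < b)) ->
  exists p q, [/\ adjacent s p q, p <= a & b <= q].
Proof.
move=> [As Bs AB sAB] Aa ab bB nab.
have [p [ps pa pmax]] := @seq_maxP (fun z => z <= a) s A As Aa.
have [q [qs bq qmin]] := @seq_minP (fun z => b <= z) s B Bs bB.
exists p, q; split => //; split => //.
  by rewrite (le_lt_trans pa)// (lt_le_trans ab).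
move=> z zs; have := nab _ zs; rewrite negb_and -!leNgt.
by move=> /orP[/(pmax _ zs)|/(qmin _ zs)]; [left|right].
Qed.

(** The value xget selects is any pair of adjacent knots around t; plinE shows
    that the choice is immaterial, a knot belonging to two such pairs. *)
Definition plin s v t :=
  let pq := xget (t, t) [set pq | adjacent s pq.1 pq.2 /\ pq.1 <= t <= pq.2] in
  chord v pq.1 pq.2 t.

Lemma plinE s v p q t : adjacent s p q -> p <= t <= q ->
  plin s v t = chord v p q t.
Proof.
move=> pq ptq; rewrite /plin; set E := [set _ | _]; set pq' := xget _ _.
have : E pq' by apply: (@xgetPex _ _ E); exists (p, q).
case: pq' => p' q' [] [/= p's q's p'q' adj'] /andP[p't tq'].
move: pq ptq => [ps qs pq adj] /andP[pt tq].
have [p'p|qp'] := adj _ p's; last first.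
  have -> : t = q by lra.
  have -> : p' = q by lra.
  by rewrite chordl chordr.
have [pp'|q'p] := adj' _ ps; last first.
  have -> : t = p by lra.
  have -> : q' = p by lra.
  by rewrite chordl chordr; lra.
have -> : p' = p by lra.
have q'q : q' <= q by case: (adj' _ qs) => //; lra.
have qq' : q <= q' by case: (adj _ q's) => //; lra.
by have -> : q' = q by lra.
Qed.

Lemma plin_knot s A B v z : spans s A B -> z \in s -> plin s v z = v z.
Proof.
move=> sAB zs; have [_ _ _ /(_ _ zs) /(adjacent_around sAB)] := sAB.
move=> [p [q [pq pzq]]]; rewrite (plinE v pq pzq).
move: pq pzq => [_ _ pq /(_ _ zs)[zp|qz]] /andP[pz zq].
  have -> : z = p by lra.
  by rewrite chordl.
have -> : z = q by lra.
by rewrite chordr.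
Qed.

Lemma plin_le s A B v w (e : R) t : spans s A B -> A <= t <= B ->
  (forall z, z \in s -> v z <= w z + e) -> plin s v t <= plin s w t + e.
Proof.
move=> sAB /(adjacent_around sAB)[p [q [apq ptq]]] vw.
rewrite !(plinE _ apq ptq); have [ps qs pq _] := apq.
have -> : chord w p q t + e = chord (fun z => w z + e) p q t.
  by have [l _ [_ H]] := chord_conv pq ptq; rewrite !H; ring.
by apply: le_chord => //; exact: vw.
Qed.

Lemma plin_mid s A B v w t : spans s A B -> A <= t <= B ->
  plin s (fun z => (v z + w z) / 2) t = (plin s v t + plin s w t) / 2.
Proof.
move=> sAB /(adjacent_around sAB)[p [q [apq ptq]]].
have [_ _ pq _] := apq; have [l _ [_ H]] := chord_conv pq ptq.
by rewrite !(plinE _ apq ptq) !H; field.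
Qed.

(** On a piece between adjacent knots both functions are affine, and meeting in
    each half of the piece gives two distinct common points. *)
Lemma plin_touch_eq s A B v w : spans s A B ->
  (forall a b, A <= a -> b <= B -> a < b ->
    exists t, a < t < b /\ plin s v t = plin s w t) ->
  forall z, z \in s -> v z = w z.
Proof.
move=> sAB touch z zs; have [_ _ _ /(_ _ zs) zAB] := sAB.
have [p [q [apq pzq]]] := adjacent_around sAB zAB.
have [ps qs pq adj] := apq.
have [Ap qB] : A <= p /\ q <= B.
  by have [_ _ _ sAB'] := sAB; have := sAB' _ ps; have := sAB' _ qs; lra.
pose c := (p + q) / 2; have [pc cq] : p < c /\ c < q by rewrite /c; lra.
have [t1 [t1pc]] := touch p c Ap (ltW (lt_le_trans cq qB)) pc.
have [t2 [t2cq]] := touch c q (ltW (le_lt_trans Ap pc)) qB cq.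
have pt2q : p <= t2 <= q by lra.
have pt1q : p <= t1 <= q by lra.
rewrite !(plinE _ apq pt1q) !(plinE _ apq pt2q) /chord.
set bv := (v q - v p) / (q - p); set bw := (w q - w p) / (q - p) => e2 e1.
have bvw : bv = bw.
  have : (bv - bw) * (t2 - t1) = 0 by lra.
  by move/eqP; rewrite mulf_eq0 => /orP[|] /eqP; lra.
have vwp : v p = w p by rewrite bvw in e1; lra.
have vwq : v q = w q.
  move: bvw; rewrite /bv /bw vwp => /(divIf _); rewrite subr_eq0 gt_eqF//.
  by move=> /(_ isT); lra.
have [zp|qz] := adj _ zs.
  by have -> : z = p by lra.
by have -> : z = q by lra.
Qed.

(** Concavity of the data as a finite system of linear inequalities: between
    adjacent knots the chord, extended to a line, lies above all the data. *)
Definition concave_data s v := forall p q, adjacent s p q ->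
  forall z, z \in s -> v z <= chord v p q z.

Lemma plin_le_chord s A B v p q t : spans s A B -> concave_data s v ->
  adjacent s p q -> A <= t <= B -> plin s v t <= chord v p q t.
Proof.
move=> sAB cv apq /(adjacent_around sAB)[p' [q' [apq' ptq']]].
rewrite (plinE v apq' ptq'); have [p's q's pq' _] := apq'.
rewrite [leRHS]chord_slope -(chord_affine _ _ t pq'); apply: le_chord => //;
  by rewrite -chord_slope; exact: cv.
Qed.

Definition interp s A B v t : \bar R :=
  if A <= t <= B then (plin s v t)%:E else -oo%E.

Lemma interp_knot s A B v z : spans s A B -> z \in s ->
  interp s A B v z = (v z)%:E.
Proof.
move=> sAB zs; have [_ _ _ /(_ _ zs)] := sAB.
by rewrite /interp => ->; rewrite (plin_knot _ sAB).
Qed.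

Lemma interp_out s A B v t : ~ (A <= t <= B) -> interp s A B v t = -oo%E.
Proof. by rewrite /interp; case: ifP. Qed.

Lemma interp_chord s A B v p q t : spans s A B -> adjacent s p q ->
  p <= t <= q -> interp s A B v t = (chord v p q t)%:E.
Proof.
move=> [_ _ _ sAB] apq ptq; rewrite /interp (plinE _ apq ptq) ifT//.
have [/sAB/andP[Ap _] /sAB/andP[_ qB] _ _] := apq; lra.
Qed.

(** A supporting line at each point of the domain gives both concavity and
    upper semicontinuity.  Outside [A, B] the complement is open, so phi is
    -oo in a whole neighbourhood. *)
Lemma supported_classC phi (A B : R) : A <= B ->
  (forall t, ~ (A <= t <= B) -> phi t = -oo%E) ->
  (forall t, A <= t <= B -> exists c d : R,
     phi t = (c * t + d)%:E /\ forall y, (phi y <= (c * y + d)%:E)%E) ->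
  classC phi.
Proof.
move=> AB out sup.
have fin t : A <= t <= B -> exists r : R, phi t = r%:E.
  by move=> /sup[c [d [-> _]]]; exists (c * t + d).
have [c0 [d0 [phA supA]]] : exists c d : R,
    phi A = (c * A + d)%:E /\ forall y, (phi y <= (c * y + d)%:E)%E.
  by apply: sup; rewrite lexx AB.
split.
- by move=> t; apply: le_lt_trans (supA t) _; rewrite ltry.
- by exists A; rewrite /edom /= phA ltNyr.
- move=> x y t /andP[t0 t1].
  move: t0; rewrite le_eqVlt => /predU1P[<-|t0].
    by rewrite mul0e subr0 mul1e add0e mul0r add0r mul1r.
  move: t1; rewrite le_eqVlt => /predU1P[->|t1].
    by rewrite subrr mul0e mul1e adde0 mul0r addr0 mul1r.
  have t1' : 0 < 1 - t by lra.
  have [xAB|/negP/out ->] := boolP (A <= x <= B); last first.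
    by rewrite mulrNy gtr0_sg// mul1e addNye leNye.
  have [yAB|/negP/out ->] := boolP (A <= y <= B); last first.
    by rewrite mulrNy gtr0_sg// mul1e addeNy leNye.
  have /sup[c [d [-> supu]]] : A <= t * x + (1 - t) * y <= B.
    apply/andP; split; nra.
  have [rx phx] := fin _ xAB; have [ry phy] := fin _ yAB.
  have := supu x; have := supu y; rewrite phx phy !lee_fin => ? ?.
  nra.
- move=> x a; rewrite lteNr -EFinN => xa.
  have [xAB|xAB] := boolP (A <= x <= B); last first.
    exists (~` `[A, B]%classic).
      apply: open_nbhs_nbhs; split.
        exact/closed_openC/interval_closed.
      by rewrite /= in_itv/=; exact/negP.
    move=> y /= /negP; rewrite in_itv/= => /negP/out ->.
    by rewrite ltry.
  have [c [d [phx supx]]] := sup _ xAB.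
  move: xa; rewrite phx lte_fin => xa.
  exists [set y | c * y + d < - a]; last first.
    move=> y /= ya; rewrite lteNr -EFinN.
    by apply: le_lt_trans (supx y) _; rewrite lte_fin.
  apply: open_nbhs_nbhs; split => //.
  apply: (@open_comp _ _ (fun y => c * y + d) [set z | z < - a]).
    move=> y _; apply: cvgD; last exact: cvg_cst.
    by apply: cvgM; [exact: cvg_cst|exact: cvg_id].
  exact: open_lt.
Qed.

(** The supporting line at t is the line through the two knots around t: by
    concavity of the data it is above all the data, hence above the affine
    pieces between them. *)
Lemma interp_supported s A B v t : spans s A B -> concave_data s v ->
  A <= t <= B ->
  exists c d : R, interp s A B v t = (c * t + d)%:E /\
    forall y, (interp s A B v y <= (c * y + d)%:E)%E.
Proof.
move=> sAB cv /(adjacent_around sAB)[p [q [apq ptq]]].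
exists ((v q - v p) / (q - p)), (v p - (v q - v p) / (q - p) * p).
split; first by rewrite (interp_chord _ sAB apq ptq) chord_slope.
move=> y; rewrite /interp; case: ifP => [yAB|_]; last exact: leNye.
by rewrite lee_fin -chord_slope; exact: plin_le_chord yAB.
Qed.

Lemma interp_classC s A B v : spans s A B -> concave_data s v ->
  classC (interp s A B v).
Proof.
move=> sAB cv; apply: (@supported_classC _ A B).
- by have [_ _ /ltW] := sAB.
- by move=> t; exact: interp_out.
- by move=> t; exact: interp_supported.
Qed.

Lemma concave_ge_chord phi v p q t : concave phi -> p < q -> p <= t <= q ->
  phi p = (v p)%:E -> phi q = (v q)%:E -> ((chord v p q t)%:E <= phi t)%E.
Proof.
move=> cphi pq ptq phip phiq; have [l l01 [tE ->]] := chord_conv pq ptq.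
by rewrite tE; have := cphi p q l l01; rewrite phip phiq -!EFinM -EFinD.
Qed.

(** If z is left of p, say, then p lies between z and q, and the inequality is
    the chord inequality on [z, q] solved for the value at z. *)
Lemma concave_le_chord phi v p q z : concave phi -> p < q -> z <= p \/ q <= z ->
  phi p = (v p)%:E -> phi q = (v q)%:E -> phi z = (v z)%:E ->
  v z <= chord v p q z.
Proof.
move=> cphi pq zpq phip phiq phiz; rewrite /chord mulrAC -lerBlDl.
rewrite ler_pdivlMr ?subr_gt0//.
case: zpq; rewrite le_eqVlt => /predU1P[e|].
- by rewrite e !subrr mul0r mulr0.
- move=> zp; have zpq : z <= p <= q by lra.
  have := concave_ge_chord cphi (lt_trans zp pq) zpq phiz phiq.
  rewrite phip lee_fin /chord mulrAC -lerBrDl ler_pdivrMr; last by lra.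
  nra.
- by rewrite e; lra.
- move=> qz; have pqz : p <= q <= z by lra.
  have := concave_ge_chord cphi (lt_trans pq qz) pqz phip phiz.
  rewrite phiq lee_fin /chord mulrAC -lerBrDl ler_pdivrMr; last by lra.
  nra.
Qed.

Lemma concave_restriction s phi v : concave phi ->
  (forall z, z \in s -> phi z = (v z)%:E) -> concave_data s v.
Proof.
move=> cphi phiv p q [ps qs pq adj] z zs.
by apply: (concave_le_chord cphi pq (adj _ zs)); exact: phiv.
Qed.

Lemma interp_le s A B phi v : spans s A B -> concave phi ->
  (forall z, z \in s -> phi z = (v z)%:E) ->
  forall t, (interp s A B v t <= phi t)%E.
Proof.
move=> sAB cphi phiv t; have [tAB|/negP tAB] := boolP (A <= t <= B); last first.
  by rewrite interp_out// leNye.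
have [p [q [apq ptq]]] := adjacent_around sAB tAB.
have [ps qs pq _] := apq; rewrite (interp_chord _ sAB apq ptq).
by apply: concave_ge_chord => //; exact: phiv.
Qed.

End Interpolation.

(** * The total mass of e^phi *)

Section Mass.
Context {R : realType}.
Implicit Types (phi chi : R -> \bar R) (f g : R -> \bar R).
Notation mu := (@lebesgue_measure R).
Local Open Scope ereal_scope.

Definition mass phi := \int[mu]_(t in setT) expeR (phi t).

(** exp is increasing, so e^phi inherits upper semicontinuity from phi. *)
Lemma classC_measurable phi : classC phi ->
  measurable_fun setT (expeR \o phi).
Proof.
move=> [_ _ _ cphi].
rewrite (_ : expeR \o phi = -%E \o (fun t => - expeR (phi t))).
  apply: measurableT_comp => //; apply: lower_semicontinuous_measurable.
  move=> t a; rewrite lteNr -EFinN => ta.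
  have a0 : (0 < - a)%R.
    by rewrite -lte_fin (le_lt_trans _ ta)// expeR_ge0.
  have aE : (- a)%:E = expeR (ln (- a))%:E by rewrite /= lnK.
  move: ta; rewrite aE lte_expeR -lteN2 -EFinN => /cphi[V Vt Va].
  exists V => // y /Va; rewrite EFinN lteN2 => ya.
  by rewrite lteNr -EFinN aE lte_expeR.
by apply/funext => t /=; rewrite oppeK.
Qed.

Lemma mass_ge0 phi : 0 <= mass phi.
Proof. by apply: integral_ge0 => t _; exact: expeR_ge0. Qed.

Lemma le_mass phi chi : classC phi -> classC chi ->
  (forall t, phi t <= chi t) -> mass phi <= mass chi.
Proof.
move=> cphi cchi le; apply: ge0_le_integral => //.
- by move=> t _; exact: expeR_ge0.
- exact: classC_measurable.
- exact: classC_measurable.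
- by move=> t _; rewrite lee_expeR.
Qed.

Lemma integral_cst_itv (a b c : R) : (a <= b)%R ->
  \int[mu]_(t in `[a, b]%classic) (cst c%:E) t = (c * (b - a))%:E.
Proof.
move=> ab; rewrite integral_cst//= lebesgue_measure_itv/= lte_fin.
move: ab; rewrite le_eqVlt => /predU1P[->|->]//.
by rewrite ltxx subrr mulr0 mule0.
Qed.

Lemma mass_le phi (A B M : R) : (A <= B)%R -> classC phi ->
  (forall t, ~ (A <= t <= B)%R -> phi t = -oo) ->
  (forall t, phi t <= M%:E) -> mass phi <= (expR M * (B - A))%:E.
Proof.
move=> AB cphi out le; rewrite -integral_cst_itv// integral_mkcond.
apply: ge0_le_integral => //.
- by move=> t _; exact: expeR_ge0.
- exact: classC_measurable.
- by apply/(measurable_restrictT _ _).1 => //; exact: measurable_itv.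
- move=> t _; rewrite patchE; case: ifPn => [_|].
    by rewrite -[leRHS]/(expeR M%:E) lee_expeR.
  by move/negP; rewrite inE/= in_itv/= => /out ->.
Qed.

Lemma mass_ge phi (a b c : R) : (a <= b)%R -> classC phi ->
  (forall t, (a <= t <= b)%R -> c%:E <= phi t) ->
  (expR c * (b - a))%:E <= mass phi.
Proof.
move=> ab cphi le; rewrite -integral_cst_itv//.
apply: (@le_trans _ _ (\int[mu]_(t in `[a, b]%classic) expeR (phi t))).
  apply: ge0_le_integral => //.
  + by move=> t _; rewrite lee_fin expR_ge0.
  + by apply: measurable_funTS; exact: classC_measurable.
  + move=> t; rewrite /= in_itv/= => /le.
    by rewrite -lee_expeR.
apply: ge0_subset_integral => //.
- exact: classC_measurable.
- by move=> t _; exact: expeR_ge0.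
Qed.

(** This multiplicative bound is what makes the mass a continuous function of
    the values at the knots. *)
Lemma mass_shift phi chi (e : R) : classC phi -> classC chi ->
  (forall t, phi t <= chi t + e%:E) -> mass phi <= (expR e)%:E * mass chi.
Proof.
move=> cphi cchi le.
have mphi := classC_measurable cphi; have mchi := classC_measurable cchi.
rewrite -ge0_integralZl// ?lee_fin ?expR_ge0//; last first.
  by move=> t _; exact: expeR_ge0.
apply: ge0_le_integral => //.
- by move=> t _; exact: expeR_ge0.
- exact: measurable_funeM.
- by move=> t _; rewrite muleC -[(expR e)%:E]/(expeR e%:E) -expeRD lee_expeR.
Qed.

(** The difference has integral 0, so it vanishes almost everywhere, and an
    interval has positive length.  This is the only way in which equality of
    masses is exploited. *)
Lemma eq_integral_eq_in_itv f g (a b : R) : (a < b)%R ->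
  measurable_fun setT f -> measurable_fun setT g ->
  (forall t, 0 <= f t) -> (forall t, f t <= g t) -> (forall t, g t < +oo) ->
  \int[mu]_t f t = \int[mu]_t g t -> \int[mu]_t g t < +oo ->
  exists t, (a < t < b)%R /\ f t = g t.
Proof.
move=> ab mf mg f0 fg goo Ifg Ig; apply: contrapT => nfg.
have g0 t : 0 <= g t by exact: le_trans (f0 t) (fg t).
have ffin t : f t \is a fin_num.
  by rewrite ge0_fin_numE// (le_lt_trans (fg t)).
have gfin t : g t \is a fin_num by rewrite ge0_fin_numE.
have intf : mu.-integrable setT f.
  apply/integrableP; split => //; under eq_integral do rewrite gee0_abs//.
  by rewrite Ifg.
have intg : mu.-integrable setT g.
  by apply/integrableP; split => //; under eq_integral do rewrite gee0_abs//.
have I0 : \int[mu]_t `|g t - f t| = 0.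
  transitivity (\int[mu]_t (g t - f t)).
    by apply: eq_integral => t _; rewrite gee0_abs// subre_ge0.
  by rewrite integralB// Ifg subee// ge0_fin_numE// integral_ge0.
have /(ae_eq_integral_abs mu measurableT)[+ _] :
    measurable_fun setT (g \- f).
  exact: emeasurable_funB.
move=> /(_ I0) [N [mN muN Nsub]].
have : mu `]a, b[%classic <= mu N.
  apply: le_measure; rewrite ?inE//.
  move=> t; rewrite /= in_itv/= => tab; apply: Nsub => /= /(_ I) gf.
  apply: nfg; exists t; split => //.
  by move: gf => /= gf; rewrite -[RHS](subeK (g t) (ffin t)) gf add0e.
rewrite muN lebesgue_measure_itv/= lte_fin ab -EFinB lee_fin.
by rewrite leNgt subr_gt0 ab.
Qed.

End Mass.

(** * The constrained maximum likelihood problem *)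

Lemma plin_cst {R : realType} (s : seq R) (c t : R) : plin s (fun=> c) t = c.
Proof. by rewrite /plin /chord subrr !mul0r addr0. Qed.

(** The unconstrained class, the class with a fixed mode and the symmetric
    class are the instances b in {}, b = m, and b in {0, - a} of rel a b.
    Constraints of this form are closed, convex and stable under truncation
    from above: this gives existence, uniqueness and argmax_le_data in turn. *)
Definition order_class {R : realType} (rel : R -> R -> Prop) :
    set (R -> \bar R) :=
  [set phi | classC phi /\ forall a b, rel a b -> (phi a <= phi b)%E].

Lemma closed_le_continuous {R : realType} (T : topologicalType) (f g : T -> R) :
  continuous f -> continuous g -> closed [set v | f v <= g v].
Proof.
move=> cf cg.
rewrite (_ : mkset _ = (fun v => g v - f v) @^-1` [set y | 0 <= y]).
  apply: closed_comp; last exact: closed_ge.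
  by move=> v _; apply: cvgB; [exact: cg|exact: cf].
by apply/seteqP; split => v /=; rewrite subr_ge0.
Qed.

Lemma chord_continuous {R : realType} (T : topologicalType) (f : T -> R -> R)
    (p q z : R) :
  (forall a, continuous (f ^~ a)) -> continuous (fun v => chord (f v) p q z).
Proof.
move=> cf v; rewrite /chord; apply: cvgD; first exact: cf.
by do 2 apply: cvgMl; apply: cvgB; exact: cf.
Qed.

Lemma classC_min {R : realType} (phi : R -> \bar R) (c y : R) :
  classC phi -> (-oo < phi y)%E -> classC (fun t => Order.min (phi t) c%:E).
Proof.
move=> [phioo _ cphi lphi] phiy; split.
- by move=> t; rewrite gt_min phioo.
- by exists y; rewrite /edom /= lt_min phiy ltNyr.
- move=> a b t t01; have /andP[t0 t1] := t01.
  have t1' : (0 <= (1 - t)%:E)%E by rewrite lee_fin subr_ge0.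
  have t0' : (0 <= t%:E)%E by rewrite lee_fin.
  rewrite le_min; apply/andP; split.
    apply: le_trans (cphi a b t t01).
    by apply: leeD; apply: lee_wpmul2l => //; rewrite ge_min lexx.
  rewrite [leRHS](_ : _ = (t%:E * c%:E + (1 - t)%:E * c%:E)%E); last first.
    by rewrite -!EFinM -EFinD -mulrDl addrC subrK mul1r.
  by apply: leeD; apply: lee_wpmul2l => //; rewrite ge_min lexx orbT.
- move=> t a; rewrite lteNr gt_min => /orP[|] ta.
    move: ta; rewrite -lteNr => /lphi[V Vt Va]; exists V => // z /Va za.
    by rewrite lteNr gt_min -lteNr za.
  exists setT; first exact: filterT.
  by move=> z _; rewrite lteNr gt_min ta orbT.
Qed.

Section Maximiser.
Context {R : realType} (n : nat) (x : 'I_n -> R) (s : seq R) (A B : R).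
Context (rel : R -> R -> Prop).
Implicit Types (v w : R -> R) (phi : R -> \bar R).

(** The vectors of knot values over which the criterion is maximised. *)
Definition admissible v := concave_data s v /\
  forall a b, a \in s -> b \in s -> rel a b -> v a <= v b.

Hypothesis sAB : spans s A B.
Hypothesis xs : forall i, x i \in s.
Hypothesis n_gt0 : (0 < n)%N.
(** Keeps the interpolant of admissible knot values in the class. *)
Hypothesis compat : forall v, admissible v ->
  forall a b, rel a b -> (interp s A B v a <= interp s A B v b)%E.
(** Makes a function of finite likelihood finite on s, and bounds its knot
    values from below in terms of its likelihood. *)
Hypothesis anchor : forall phi, order_class rel phi ->
  forall z, z \in s -> exists i, (phi (x i) <= phi z)%E.

Let nR_gt0 : 0 < n%:R :> R. Proof. by rewrite ltr0n. Qed.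
Let AB : A <= B. Proof. by have [_ _ /ltW] := sAB. Qed.

Lemma interp_order_class v : admissible v -> order_class rel (interp s A B v).
Proof.
move=> av; split; last exact: compat.
by apply: interp_classC => //; case: av.
Qed.

Lemma order_class_admissible phi v : order_class rel phi ->
  (forall z, z \in s -> phi z = (v z)%:E) -> admissible v.
Proof.
move=> [[_ _ cphi _] rphi] phiv; split; first exact: concave_restriction phiv.
by move=> a b sa sb /rphi; rewrite !phiv.
Qed.

Lemma admissible_eq v w : (forall z, z \in s -> v z = w z) ->
  admissible v -> admissible w.
Proof.
move=> vw [cv rv]; split.
  move=> p q apq z zs; have [ps qs _ _] := apq.
  by rewrite /chord -!vw//; exact: cv.
by move=> a b sa sb /rv; rewrite -!vw//; exact.
Qed.

Lemma interp_eq v w : (forall z, z \in s -> v z = w z) ->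
  interp s A B v = interp s A B w.
Proof.
move=> vw; apply/funext => t; rewrite /interp; case: ifP => // tAB.
congr EFin; apply/eqP; rewrite eq_le -[leRHS]addr0 -[X in _ && (_ <= X)]addr0.
by rewrite !(plin_le sAB)// => z /vw ->; rewrite addr0.
Qed.

Lemma admissible0 : admissible (fun=> 0).
Proof.
split => // p q apq z zs.
by rewrite /chord subrr !mul0r addr0.
Qed.

Lemma admissible_mid v w : admissible v -> admissible w ->
  admissible (fun z => (v z + w z) / 2).
Proof.
move=> [cv rv] [cw rw]; split => [p q apq z zs|a b sa sb ab]; last first.
  by have := rv _ _ sa sb ab; have := rw _ _ sa sb ab; lra.
have := cv _ _ apq _ zs; have := cw _ _ apq _ zs.
have -> : chord (fun z => (v z + w z) / 2) p q z =
    (chord v p q z + chord w p q z) / 2 by rewrite /chord; ring.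
lra.
Qed.

Lemma interp_ub v (M : R) : (forall z, z \in s -> v z <= M) ->
  forall t, (interp s A B v t <= M%:E)%E.
Proof.
move=> vM t; rewrite /interp; case: ifP => [tAB|_]; last exact: leNye.
have := plin_le (w := fun=> 0) (e := M) sAB tAB.
by rewrite plin_cst add0r lee_fin; apply => z /vM.
Qed.

Lemma interp_lb v (m : R) : (forall z, z \in s -> m <= v z) ->
  forall t, A <= t <= B -> (m%:E <= interp s A B v t)%E.
Proof.
move=> vm t tAB; rewrite /interp tAB lee_fin.
have := plin_le (v := fun=> m) (w := v) (e := 0) sAB tAB.
by rewrite plin_cst addr0; apply => z /vm; rewrite ?addr0.
Qed.

Lemma knot_max v : exists2 z0, z0 \in s & forall z, z \in s -> v z <= v z0.
Proof.
have [As _ _ _] := sAB.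
have [_ [/mapP[z0 z0s ->] _ vmax]] :=
  @seq_maxP _ predT (map v s) (v A) (map_f v As) isT.
by exists z0 => // z zs; apply: vmax => //; exact: map_f.
Qed.

Lemma mass_interp_fin v : admissible v -> mass (interp s A B v) \is a fin_num.
Proof.
move=> [cv _]; have [z0 _ vmax] := knot_max v.
rewrite ge0_fin_numE ?mass_ge0//.
apply: le_lt_trans (mass_le AB (interp_classC sAB cv) _ (interp_ub vmax)) _.
  by move=> t; exact: interp_out.
exact: ltry.
Qed.

Definition avg v := n%:R^-1 * \sum_(i < n) v (x i).

(** The criterion of the interpolant, as a real number (Psi_interp). *)
Definition score v := avg v - fine (mass (interp s A B v)).

Lemma Psi_fin phi v : (forall i, phi (x i) = (v (x i))%:E) ->
  Psi x phi = ((avg v)%:E - mass phi)%E.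
Proof.
move=> phiv; rewrite /Psi; congr (_ - _)%E.
by under eq_bigr do rewrite phiv; rewrite sumEFin.
Qed.

Lemma Psi_interp v : admissible v -> Psi x (interp s A B v) = (score v)%:E.
Proof.
move=> av; rewrite (@Psi_fin _ v) => [|i]; last by rewrite (interp_knot _ sAB).
by rewrite /score EFinB fineK// mass_interp_fin.
Qed.

Lemma le_avg v w (e : R) : (forall z, z \in s -> v z <= w z + e) ->
  avg v <= avg w + e.
Proof.
move=> vw; rewrite -(ler_pM2l nR_gt0) mulrDr /avg !mulVKf ?gt_eqF//.
have -> : n%:R * e = \sum_(i < n) e by rewrite sumr_const card_ord mulr_natl.
by rewrite -big_split/=; apply: ler_sum => i _; exact: vw.
Qed.

(** A function with finite criterion is finite at the observations, hence on s
    by anchor. *)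
Lemma finite_Psi_data phi : order_class rel phi -> Psi x phi != -oo%E ->
  exists v, [/\ admissible v, forall z, z \in s -> phi z = (v z)%:E &
    (Psi x phi = (avg v)%:E - mass phi)%E].
Proof.
move=> Fphi PsiN.
have [[phioo _ _ _] _] := Fphi.
have phix i : (-oo < phi (x i))%E.
  rewrite ltNye; apply/negP => /eqP phii; move/negP: PsiN; apply.
  rewrite /Psi (bigD1 i)//= phii addNye mulrNy gtr0_sg ?invr_gt0// mul1e.
  by rewrite addNye.
have phis z : z \in s -> phi z = (fine (phi z))%:E.
  move=> zs; have [i phiiz] := anchor Fphi zs.
  rewrite fineK// fin_numE -ltNye -ltey phioo andbT.
  exact: lt_le_trans phiiz.
exists (fine \o phi); split => //; first exact: (order_class_admissible Fphi).
by apply: Psi_fin => i; exact: phis.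
Qed.


(** From the knot z0 of largest value, go towards the farther end of [A, B], a
    fraction 1 / (1 + r) of the way.  The loss is at most r at the end, so
    concavity keeps it below 1 on that part, whose length is at least
    (B - A) / 2 / (1 + r). *)
Lemma mass_interp_ge v z0 (r : R) : admissible v -> z0 \in s -> 0 <= r ->
  (forall z, z \in s -> v z0 - r <= v z) ->
  expR (v z0 - 1) * ((B - A) / 2 / (1 + r)) <= fine (mass (interp s A B v)).
Proof.
move=> av z0s r0 vlb; have [_ _ ltAB /(_ _ z0s) /andP[Az0 z0B]] := sAB.
have cls := interp_classC sAB av.1; have [_ _ cphi _] := cls.
have D0 : 0 < 1 + r by lra.
rewrite -lee_fin fineK ?mass_interp_fin//.
have onseg e l : A <= e <= B -> 0 <= l <= (1 + r)^-1 ->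
    ((v z0 - 1)%:E <= interp s A B v (l * e + (1 - l) * z0))%E.
  move=> eAB /andP[l0 lD]; have lr : l * r <= 1.
    have : l * (1 + r) <= 1 by rewrite -ler_pdivlMr// div1r.
    nra.
  have l1 : l <= 1 by apply: le_trans lD _; rewrite invf_le1//; lra.
  apply: le_trans (cphi e z0 l _); last by rewrite l0.
  have [y ye vy] : exists2 y, interp s A B v e = y%:E & v z0 - r <= y.
    exists (plin s v e); first by rewrite /interp eAB.
    by rewrite -lee_fin; have := interp_lb vlb eAB; rewrite /interp eAB.
  rewrite ye (interp_knot _ sAB z0s) -!EFinM -EFinD lee_fin; nra.
have half : (B - A) / 2 <= B - z0 \/ (B - A) / 2 <= z0 - A by lra.
set h := (B - A) / 2 in half *; have h0 : 0 <= h by rewrite /h; lra.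
have hD : 0 <= h / (1 + r) by rewrite divr_ge0//; lra.
case: half => hz0.
- have Bz0 : 0 < B - z0 by rewrite /h in hz0; lra.
  have -> : h / (1 + r) = z0 + h / (1 + r) - z0 by ring.
  apply: mass_ge => //; first by lra.
  move=> t /andP[z0t th].
  have -> : t = (t - z0) / (B - z0) * B + (1 - (t - z0) / (B - z0)) * z0.
    by field; lra.
  apply: onseg; first lra.
  rewrite divr_ge0/=; [|lra|lra].
  rewrite ler_pdivrMr// mulrC; apply: (@le_trans _ _ (h / (1 + r))); first lra.
  by rewrite ler_pM2r// invr_gt0.
- have Bz0 : 0 < z0 - A by rewrite /h in hz0; lra.
  have -> : h / (1 + r) = z0 - (z0 - h / (1 + r)) by ring.
  apply: mass_ge => //; first by lra.
  move=> t /andP[z0t th].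
  have -> : t = (z0 - t) / (z0 - A) * A + (1 - (z0 - t) / (z0 - A)) * z0.
    by field; lra.
  apply: onseg; first lra.
  rewrite divr_ge0/=; [|lra|lra].
  rewrite ler_pdivrMr// mulrC; apply: (@le_trans _ _ (h / (1 + r))); first lra.
  by rewrite ler_pM2r// invr_gt0.
Qed.

(** Cubing 1 + u / 3 <= e^(u / 3) gives u^3 / 27 <= e^u, and a cubic dominates
    the quadratic on the right. *)
Lemma exp_beats_square (c k : R) : 0 < c -> 0 <= k ->
  exists2 U, 0 <= U & forall u, 0 <= u -> c * expR u <= u * (1 + k * u) -> u <= U.
Proof.
move=> c0 k0; exists (27 * (1 + k) / c + 1) => [|u u0 cu].
  by rewrite addr_ge0// divr_ge0 ?(ltW c0)// mulr_ge0//; lra.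
rewrite leNgt; apply/negP => Uu.
have u1 : 1 < u.
  apply: le_lt_trans Uu; rewrite lerDr divr_ge0 ?(ltW c0)// mulr_ge0//; lra.
have cu27 : 27 * (1 + k) < c * u.
  rewrite [ltRHS]mulrC -ltr_pdivrMr//; apply: lt_trans Uu; lra.
have e3 : (u / 3) ^+ 3 <= expR u.
  have -> : expR u = expR (u / 3) ^+ 3.
    by rewrite -expRM_natl; congr expR; field.
  apply: lerXn2r; rewrite ?nnegrE ?expR_ge0//; first lra.
  by apply: le_trans (expR_ge1Dx _); lra.
have {}cu : c * (u / 3) ^+ 3 <= u * (1 + k * u).
  by apply: le_trans cu; rewrite ler_pM2l.
have : 27 * (1 + k) * (u * u) < c * u * (u * u) by rewrite ltr_pM2r//; nra.
have -> : c * u * (u * u) = 27 * (c * (u / 3) ^+ 3) by field.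
move=> h; have : (1 + k) * (u * u) < u * (1 + k * u) by lra.
nra.
Qed.

(** Write u for the excess of the largest knot value over J0.  As the mean of
    the observed values is at least J0 and each of them is at most J0 + u, each
    of them is at least J0 + u - n u, and by anchor so is every knot value.
    The mass is at most u, while mass_interp_ge bounds it from below by a
    multiple of e^u / (1 + n u): so u is bounded. *)
Lemma coercive (J0 : R) : exists2 M, 0 <= M & forall v, admissible v ->
  J0 <= score v -> forall z, z \in s -> - M <= v z <= M.
Proof.
have [_ _ ltAB _] := sAB.
pose c := expR (J0 - 1) * ((B - A) / 2).
have c0 : 0 < c by rewrite mulr_gt0 ?expR_gt0//; lra.
have [U U0 HU] := exp_beats_square c0 (ltW nR_gt0).
exists (`|J0| + U + n%:R * U) => [|v av Jv].
  by rewrite !addr_ge0// mulr_ge0// ltW.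
have [z0 z0s vmax] := knot_max v.
have m0 : 0 <= fine (mass (interp s A B v)) by rewrite fine_ge0// mass_ge0.
set mm := fine _ in m0; move: Jv; rewrite /score -/mm => Jv.
have avg_le : avg v <= v z0.
  have := @le_avg v (fun=> 0) (v z0).
  by rewrite {2}/avg big1// mulr0 !add0r; apply => z /vmax.
pose u := v z0 - J0; have u0 : 0 <= u by rewrite /u; lra.
have mmu : mm <= u by rewrite /u; lra.
have vx i : v z0 - n%:R * u <= v (x i).
  have : n%:R * J0 <= \sum_(i < n) v (x i).
    by rewrite -ler_pdivlMl//; rewrite -/(avg v); lra.
  rewrite (bigD1 i)//= => sumv.
  have : \sum_(j < n | j != i) v (x j) <= \sum_(j < n | j != i) v z0.
    by apply: ler_sum => j _; exact: vmax.
  rewrite sumr_const cardC1 card_ord -[v z0 *+ _]mulr_natl -subn1 natrB// => sum2.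
  rewrite /u; lra.
have vlb z : z \in s -> v z0 - n%:R * u <= v z.
  move=> zs; have [i] := anchor (interp_order_class av) zs.
  rewrite !(interp_knot _ sAB)// lee_fin; exact: le_trans.
have nu0 : 0 <= n%:R * u by rewrite mulr_ge0// ltW.
have := mass_interp_ge av z0s nu0 vlb; rewrite -/mm => mge.
have uU : u <= U.
  apply: HU => //; rewrite -ler_pdivrMr; last by lra.
  apply: le_trans mmu; apply: le_trans mge.
  rewrite le_eqVlt; apply/orP; left; apply/eqP.
  rewrite /c (_ : v z0 - 1 = u + (J0 - 1)); last by rewrite /u; ring.
  rewrite (expRD u); ring.
move=> z zs; have := vlb _ zs; have := vmax _ zs.
have nuU : n%:R * u <= n%:R * U by rewrite ler_pM2l.
have := ler_norm J0; have := ler_norm (- J0); rewrite normrN /u in uU nuU *.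
by move=> *; apply/andP; split; lra.
Qed.


(** Knot values are coordinates in the product topology, and there are finitely
    many of them. *)
Lemma near_knots v (e : R) : 0 < e ->
  \forall w \near (v : {ptws R -> R}), forall z, z \in s -> `|v z - w z| < e.
Proof.
move=> e0; elim: (s) => [|a l IH].
  by apply: filterS (@filterT _ (nbhs (v : {ptws R -> R})) _) => w _ z.
have a_near : \forall w \near (v : {ptws R -> R}), `|v a - w a| < e.
  exact: (@proj_continuous R (fun=> R) a v _ (nbhsx_ballx (v a) e e0)).
apply: filterS (@filterI _ (nbhs (v : {ptws R -> R})) _ _ _ a_near IH).
move=> w [wa wl] z.
by rewrite inE => /predU1P[->//|]; exact: wl.
Qed.

Lemma mass_interp_near v w (d K : R) : admissible v -> admissible w -> 0 <= d ->
  (forall z, z \in s -> `|v z - w z| <= d) ->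
  fine (mass (interp s A B v)) <= K -> fine (mass (interp s A B w)) <= K ->
  `|fine (mass (interp s A B v)) - fine (mass (interp s A B w))|
    <= (expR d - 1) * K.
Proof.
move=> av aw d0 vw vK wK.
have key v' w' : admissible v' -> admissible w' ->
    (forall z, z \in s -> `|v' z - w' z| <= d) ->
    fine (mass (interp s A B w')) <= K ->
    fine (mass (interp s A B v')) - fine (mass (interp s A B w'))
      <= (expR d - 1) * K.
  move=> av' aw' vw' wK'.
  have : fine (mass (interp s A B v')) <= expR d * fine (mass (interp s A B w')).
    rewrite -lee_fin EFinM !fineK ?mass_interp_fin//.
    apply: mass_shift; [exact: interp_classC av'.1|exact: interp_classC aw'.1|].
    move=> t; rewrite /interp; case: ifP => tAB; last by rewrite leNye.
    rewrite -EFinD lee_fin; apply: plin_le sAB tAB _ => z /vw'.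
    by rewrite ler_norml; lra.
  have : 1 <= expR d by rewrite -expR0 ler_expR.
  have : 0 <= fine (mass (interp s A B w')) by rewrite fine_ge0// mass_ge0.
  nra.
rewrite ler_norml; have := key v w av aw vw wK.
have : fine (mass (interp s A B w)) - fine (mass (interp s A B v))
      <= (expR d - 1) * K.
  by apply: key => // z /vw; rewrite distrC.
lra.
Qed.

(** The values off the knots are irrelevant for the score, so they can be kept
    in [-M, M] and the box is compact by Tychonoff's theorem. *)
Lemma score_max : exists2 v, admissible v &
  forall w, admissible w -> score w <= score v.
Proof.
have [M M0 HM] := coercive (score (fun=> 0)).
pose box : set {ptws R -> R} := [set v | forall z, `[-M, M]%classic (v z)].
pose adm : set {ptws R -> R} := [set v | admissible v].
have box0 : box (fun=> 0) by move=> z; rewrite /= in_itv/=; lra.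
have coord z : continuous (fun v : {ptws R -> R} => v z).
  exact: (@proj_continuous R (fun=> R) z).
have adm_closed : closed adm.
  rewrite (_ : adm =
      \bigcap_(pq in [set pq | adjacent s pq.1 pq.2]) \bigcap_(z in [set` s])
        [set v | v z <= chord v pq.1 pq.2 z] `&`
      \bigcap_(ab in [set ab | [/\ ab.1 \in s, ab.2 \in s & rel ab.1 ab.2]])
        [set v | v ab.1 <= v ab.2]).
    apply: closedI.
      apply: closed_bigI => -[p q] _; apply: closed_bigI => z _.
      apply: (@closed_le_continuous _ {ptws R -> R} (fun v => v z)).
        exact: coord.
      exact: (@chord_continuous _ {ptws R -> R} (fun v z => v z)).
    apply: closed_bigI => -[a b] _.
    by apply: (@closed_le_continuous _ {ptws R -> R} (fun v => v a)); exact: coord.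
  apply/seteqP; split => v /=.
    move=> [cv rv]; split; last by move=> [a b] [/= ? ? ?]; exact: rv.
    by move=> [p q] apq z zs; exact: cv.
  move=> [cv rv]; split; last by move=> a b ? ? ?; exact: (rv (a, b)).
  by move=> p q apq z zs; exact: (cv (p, q)).
have cpt : compact (box `&` adm).
  apply: compact_closedI => //.
  apply: (@tychonoff R (fun=> R) (fun=> `[-M, M]%classic)) => _.
  exact: segment_compact.
have massK v : (box `&` adm) v -> fine (mass (interp s A B v)) <= expR M * (B - A).
  move=> [bv av]; rewrite -lee_fin fineK ?mass_interp_fin//.
  apply: mass_le => //; first exact: interp_classC av.1.
    by move=> t; exact: interp_out.
  by apply: interp_ub => z _; have := bv z; rewrite /= in_itv/= => /andP[].
have K0 : 0 <= expR M * (B - A) by rewrite mulr_ge0 ?expR_ge0// subr_ge0.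
set K := _ * (B - A) in massK K0.
have cts : {within box `&` adm, continuous score}.
  apply/subspace_continuousP => v Cv; apply/cvgrPdist_lt => e e0.
  (* d bounds the change of the mean, (e^d - 1) K that of the mass. *)
  pose d := Num.min (e / 3) (ln (1 + e / (3 * (K + 1)))).
  have eK : 0 < e / (3 * (K + 1)) by rewrite divr_gt0// mulr_gt0//; lra.
  have d0 : 0 < d by rewrite /d lt_min ln_gt0 ?andbT; lra.
  have d1 : d <= e / 3 by rewrite /d ge_min lexx.
  have d2 : (expR d - 1) * K < e / 3.
    have : expR d <= 1 + e / (3 * (K + 1)).
      by rewrite -[leRHS]lnK ?posrE ?ler_expR ?ge_min ?lexx ?orbT//; lra.
    have -> : e / (3 * (K + 1)) = e / 3 / (K + 1) by field; lra.
    rewrite -lerBlDl ler_pdivlMr; last by lra.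
    have : 1 < expR d by rewrite -expR0 ltr_expR.
    nra.
  rewrite near_withinE; near=> w => Cw; change (`|score v - score w| < e).
  have vw : forall z, z \in s -> `|v z - w z| < d.
    by near: w; exact: near_knots.
  have := @mass_interp_near v w d K Cv.2 Cw.2 (ltW d0)
    (fun z zs => ltW (vw z zs)) (massK _ Cv) (massK _ Cw).
  have : avg v <= avg w + d.
    by apply: le_avg => z /vw; rewrite ltr_norml; lra.
  have : avg w <= avg v + d.
    by apply: le_avg => z /vw; rewrite ltr_norml; lra.
  rewrite ler_norml ltr_norml /score; lra.
have C0 : (box `&` adm) (fun=> 0) by split => //; exact: admissible0.
have C_neq0 : box `&` adm !=set0 by exists (fun=> 0).
have [v] := compact_EVT_max C_neq0 cpt cts.
rewrite inE => -[_ av] vmax; exists v => // w aw.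
have [w0|w0] := leP (score w) (score (fun=> 0)).
  by apply: le_trans w0 _; apply: vmax; rewrite inE.
(* w agrees on the knots with a member of the box. *)
pose w' z := if z \in s then w z else 0.
have ww' z : z \in s -> w z = w' z by rewrite /w' => ->.
have -> : score w = score w'.
  rewrite /score (interp_eq ww') /avg; congr (_ * _ - _).
  by apply: eq_bigr => i _; exact: ww'.
apply: vmax; rewrite inE; split; last exact: admissible_eq aw.
move=> z; rewrite /= in_itv/= /w'; case: ifPn => [zs|_]; last by lra.
exact: HM (ltW w0) _ zs.
Unshelve. all: by end_near. Qed.


Lemma score_max_argmax v : admissible v ->
  (forall w, admissible w -> score w <= score v) ->
  is_argmax (order_class rel) (Psi x) (interp s A B v).
Proof.
move=> av vmax; split; first exact: interp_order_class.
move=> chi Fchi; have [->|PsiN] := eqVneq (Psi x chi) -oo%E; first exact: leNye.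
have [w [aw chiw ->]] := finite_Psi_data Fchi PsiN.
rewrite Psi_interp//; apply: (@le_trans _ _ (score w)%:E); last first.
  by rewrite lee_fin; exact: vmax.
rewrite -Psi_interp// (@Psi_fin _ w) => [|i]; last by rewrite (interp_knot _ sAB).
apply: leeB => //; have [cchi _] := Fchi; have [_ _ cc _] := cchi.
apply: le_mass => //; first exact: interp_classC aw.1.
exact: interp_le.
Qed.

(** The interpolant of phi is below phi and competes with it, so the masses are
    equal and the two functions touch in every interval (touch).  A point where
    phi is strictly larger would, by concavity, make phi strictly larger in the
    whole interval from that point to a knot. *)
Lemma argmax_interp phi : is_argmax (order_class rel) (Psi x) phi ->
  exists2 v, admissible v & phi = interp s A B v.
Proof.
move=> [Fphi phimax]; have [cphi _] := Fphi; have [phioo _ ccphi _] := cphi.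
have PsiN : Psi x phi != -oo%E.
  have := phimax _ (interp_order_class admissible0).
  by rewrite (Psi_interp admissible0) -ltNye => /(lt_le_trans _); apply; rewrite ltNyr.
have [v [av phiv PsiE]] := finite_Psi_data Fphi PsiN.
exists v => //; have cv := interp_classC sAB av.1.
have vphi := interp_le sAB ccphi phiv.
have mass_phi : mass phi = mass (interp s A B v).
  apply/le_anti/andP; split; last exact: le_mass.
  have := phimax _ (interp_order_class av).
  rewrite PsiE (@Psi_fin _ v) => [|i]; last by rewrite (interp_knot _ sAB).
  have := mass_interp_fin av; case: (mass (interp s A B v)) => [r| |]//= _.
  case: (mass phi) => [r'| |]//; first by rewrite -!EFinB !lee_fin; lra.
  by rewrite ?leNye ?leeNy_eq.
have touch a b : a < b -> exists t, a < t < b /\ phi t = interp s A B v t.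
  move=> ab; have := @eq_integral_eq_in_itv R (fun t => expeR (interp s A B v t))
    (fun t => expeR (phi t)) a b ab.
  case=> [| | | | | | |t [tab /expeR_inj e]].
  - exact: classC_measurable.
  - exact: classC_measurable.
  - by move=> t; exact: expeR_ge0.
  - by move=> t; rewrite lee_expeR.
  - by move=> t; rewrite ltey expeR_eqy -ltey.
  - by rewrite -/(mass phi) mass_phi.
  - by rewrite -/(mass phi) mass_phi ltey_eq mass_interp_fin.
  - by exists t.
apply/funext => t; apply/eqP; rewrite eq_le vphi andbT leNgt; apply/negP => lt.
have [r phit] : exists r, phi t = r%:E.
  exists (fine (phi t)); rewrite fineK// fin_numE -ltNye -ltey phioo andbT.
  exact: le_lt_trans (leNye _) lt.
have outside e y : (e = A \/ e = B) -> e != t ->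
    (e < y < t) || (t < y < e) -> (-oo < phi y)%E.
  move=> eAB et ey; have es : e \in s by have [As Bs _ _] := sAB; case: eAB => ->.
  pose w z := if z == e then v e else r.
  have we : phi e = (w e)%:E by rewrite /w eqxx phiv.
  have wt : phi t = (w t)%:E by rewrite /w eq_sym (negbTE et).
  case/orP: ey => /andP[ey yt].
    have := @concave_ge_chord _ phi w e t y ccphi (lt_trans ey yt) _ we wt.
    by move=> /(_ _)/(lt_le_trans _); apply; rewrite ?ltNyr// !ltW.
  have := @concave_ge_chord _ phi w t e y ccphi (lt_trans ey yt) _ wt we.
  by move=> /(_ _)/(lt_le_trans _); apply; rewrite ?ltNyr// !ltW.
have [tA|At] := ltP t A.
  have [y [/andP[ty yA] phiy]] := touch _ _ tA.
  have := outside A y (or_introl erefl); rewrite gt_eqF// ty yA orbT phiy.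
  by rewrite interp_out ?ltxx => [/(_ isT isT)//|]; lra.
have [Bt|tB] := ltP B t.
  have [y [/andP[By yt] phiy]] := touch _ _ Bt.
  have := outside B y (or_intror erefl); rewrite lt_eqF// By yt phiy.
  by rewrite interp_out ?ltxx => [/(_ isT isT)//|]; lra.
have tAB : A <= t <= B by rewrite At tB.
have [p [q [apq /andP[]]]] := adjacent_around sAB tAB.
have [ps qs pq _] := apq.
rewrite le_eqVlt => /predU1P[pt|pt tq].
  by move: lt; rewrite -pt phiv// (interp_knot _ sAB)// ltxx.
have [y [/andP[py yt] phiy]] := touch _ _ pt.
have ytq : p <= y <= q by lra.
have ptq : p <= t <= q by lra.
move: lt; rewrite phit (interp_chord _ sAB apq ptq) lte_fin => lt.
pose w z := if z == p then v p else r.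
have wp : phi p = (w p)%:E by rewrite /w eqxx phiv.
have wt : phi t = (w t)%:E by rewrite /w gt_eqF.
have pyt : p <= y <= t by lra.
have := concave_ge_chord ccphi pt pyt wp wt.
rewrite phiy (interp_chord _ sAB apq ytq) lee_fin.
have [l l01 [yE ->]] := chord_conv pt pyt.
have wpv : w p = v p by rewrite /w eqxx.
have wtr : w t = r by rewrite /w gt_eqF.
have -> : chord v p q y = l * v p + (1 - l) * chord v p q t.
  by rewrite yE /chord; ring.
rewrite wpv wtr; apply/negP; rewrite -ltNge.
have l1 : l < 1.
  rewrite lt_neqAle; case/andP: l01 => _ ->; rewrite andbT.
  by apply/eqP => l1; move: py; rewrite yE l1; lra.
nra.
Qed.

Lemma expR_mid (a b : R) : expR ((a + b) / 2) <= (expR a + expR b) / 2.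
Proof.
have -> : (a + b) / 2 = a / 2 + b / 2 by field.
rewrite {2}(splitr a) {2}(splitr b) !expRD.
by have := sqr_ge0 (expR (a / 2) - expR (b / 2)); rewrite sqrrB; nra.
Qed.

(** The defect of the midpoint inequality is half the square of
    e^(a / 2) - e^(b / 2). *)
Lemma expR_mid_eq (a b : R) : expR ((a + b) / 2) = (expR a + expR b) / 2 -> a = b.
Proof.
have -> : (a + b) / 2 = a / 2 + b / 2 by field.
rewrite {2}(splitr a) {2}(splitr b) !expRD => h.
have : (expR (a / 2) - expR (b / 2)) ^+ 2 = 0 by rewrite sqrrB; nra.
by move/eqP; rewrite sqrf_eq0 subr_eq0 => /eqP/expR_inj; lra.
Qed.

(** The midpoint h of the two vectors of knot values is admissible, and its
    likelihood term is the mean of the two.  Optimality therefore makes its mass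
    at least the mean of the two masses, and the convexity of exp at most. *)
Lemma argmax_uniq phi chi : is_argmax (order_class rel) (Psi x) phi ->
  is_argmax (order_class rel) (Psi x) chi -> phi = chi.
Proof.
move=> mphi mchi; have [v av phiE] := argmax_interp mphi.
have [w aw chiE] := argmax_interp mchi; subst phi chi.
pose h z := (v z + w z) / 2; have ah : admissible h by exact: admissible_mid.
have hv : score h <= score v.
  by rewrite -lee_fin -!Psi_interp//; apply: mphi.2; exact: interp_order_class.
have wv : score w = score v.
  apply/le_anti/andP; rewrite -!lee_fin -!Psi_interp//.
  by split; [apply: mphi.2|apply: mchi.2]; exact: interp_order_class.
have avgh : avg h = (avg v + avg w) / 2.
  by rewrite /avg /h -mulr_suml big_split/=; field; rewrite gt_eqF.
pose f t := expeR (interp s A B h t).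
pose g t := (2^-1%:E * (expeR (interp s A B v t) + expeR (interp s A B w t)))%E.
have mv := classC_measurable (interp_classC sAB av.1).
have mw := classC_measurable (interp_classC sAB aw.1).
have mh := classC_measurable (interp_classC sAB ah.1).
have fE t : A <= t <= B -> f t = (expR ((plin s v t + plin s w t) / 2))%:E.
  by move=> tAB; rewrite /f /interp tAB/= (plin_mid _ _ sAB).
have gE t : A <= t <= B -> g t = ((expR (plin s v t) + expR (plin s w t)) / 2)%:E.
  by move=> tAB; rewrite /g /interp tAB/= mulrC.
have fg t : (f t <= g t)%E.
  have [tAB|/negP tAB] := boolP (A <= t <= B).
    by rewrite fE// gE// lee_fin expR_mid.
  by rewrite /f interp_out//= mule_ge0// adde_ge0// expeR_ge0.
have mg : measurable_fun setT g.
  by apply: measurable_funeM; exact: emeasurable_funD.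
have Ig : (\int[@lebesgue_measure R]_t g t =
    2^-1%:E * (mass (interp s A B v) + mass (interp s A B w)))%E.
  rewrite ge0_integralZl//; last 2 first.
  - exact: emeasurable_funD.
  - by move=> t _; rewrite adde_ge0// expeR_ge0.
  by rewrite ge0_integralD// => t _; exact: expeR_ge0.
have If : mass (interp s A B h) = (\int[@lebesgue_measure R]_t g t)%E.
  apply/le_anti/andP; split.
    by apply: ge0_le_integral => // t _; [exact: expeR_ge0|exact: fg].
  rewrite Ig -(fineK (mass_interp_fin av)) -(fineK (mass_interp_fin aw)).
  rewrite -(fineK (mass_interp_fin ah)) -EFinD -EFinM lee_fin.
  move: hv wv; rewrite /score avgh; lra.
have touch a b : A <= a -> b <= B -> a < b ->
    exists t, a < t < b /\ plin s v t = plin s w t.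
  move=> Aa bB ab; have := @eq_integral_eq_in_itv R f g a b ab mh mg.
  case=> [| | | | |t [tab]].
  - by move=> t; exact: expeR_ge0.
  - exact: fg.
  - move=> t; rewrite /g /interp; case: ifP => _; first by rewrite ltry.
    by rewrite /= adde0 mule0 ltry.
  - exact: If.
  - by rewrite -If ltey_eq mass_interp_fin.
  have tAB : A <= t <= B by lra.
  by rewrite fE// gE// => -[/expR_mid_eq]; exists t.
by apply: interp_eq; exact: plin_touch_eq touch.
Qed.

Lemma argmax_exists_uniq :
  exists! phi, is_argmax (order_class rel) (Psi x) phi.
Proof.
have [v av vmax] := score_max.
exists (interp s A B v); split; first exact: score_max_argmax.
by move=> chi; apply: argmax_uniq; exact: score_max_argmax.
Qed.

(** Truncating phi at its largest observed value changes no observed value and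
    does not increase the mass, so the truncation is a maximiser too, and it equals phi
    by uniqueness. *)
Lemma argmax_le_data phi : is_argmax (order_class rel) (Psi x) phi ->
  exists i, forall t, (phi t <= phi (x i))%E.
Proof.
move=> mphi; have [v av phiE] := argmax_interp mphi.
have [Fphi _] := mphi; have [cphi rphi] := Fphi.
have phix i : phi (x i) = (v (x i))%:E by rewrite phiE (interp_knot _ sAB).
have [k _ kmax] := @arg_maxP _ _ _ (Ordinal n_gt0) predT (v \o x) isT.
have data_le i : (phi (x i) <= (v (x k))%:E)%E by rewrite phix lee_fin; exact: kmax.
pose chi t := Order.min (phi t) (v (x k))%:E.
have cchi : classC chi.
  apply: (@classC_min _ _ _ (x k)) => //.
  by rewrite phix ltNyr.
have chix i : chi (x i) = (v (x i))%:E.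
  by rewrite /chi (min_idPl (data_le i)) phix.
suff <- : chi = phi.
  by exists k => t; rewrite chix /chi ge_min lexx orbT.
apply: argmax_uniq => //; split => [|psi Fpsi].
  split=> // a b /rphi ab.
  by rewrite /chi le_min !ge_min ab lexx orbT.
apply: le_trans (mphi.2 _ Fpsi) _.
rewrite !(@Psi_fin _ v)//; apply: leeB => //.
by apply: le_mass => // t; rewrite /chi ge_min lexx.
Qed.

End Maximiser.

(** * Shape of the interpolants *)

Section Structure.
Context {R : realType}.
Implicit Types (s l : seq R) (v : R -> R) (phi : R -> \bar R).

Lemma sorted_no_between (d : R) l i z : sorted <=%R l -> (i.+1 < size l)%N ->
  z \in l -> ~~ (nth d l i < z < nth d l i.+1).
Proof.
move=> sl il /(nthP d)[j jl <-]; rewrite negb_and -!leNgt.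
have mono := sorted_leq_nth (@le_trans _ R) (@lexx _ R) d sl.
have [ji|ij] := leqP j i.
  by rewrite mono ?inE// (ltn_trans _ il).
by rewrite orbC mono ?inE.
Qed.

Lemma interp_linear_on s A B v a b : spans s A B -> A <= a -> a <= b -> b <= B ->
  (forall z, z \in s -> ~~ (a < z < b)) -> linear_on (interp s A B v) a b.
Proof.
move=> sAB Aa; rewrite le_eqVlt => /predU1P[<-|ab] bB nab.
  exists 0, (plin s v a) => t; rewrite -eq_le => /eqP <-.
  by rewrite mul0r add0r /interp Aa bB.
have [p [q [apq pa bq]]] := adjacent_between sAB Aa ab bB nab.
exists ((v q - v p) / (q - p)), (v p - (v q - v p) / (q - p) * p) => t tab.
by rewrite (interp_chord _ sAB apq) ?chord_slope//; lra.
Qed.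

Lemma edom_interp s A B v : edom (interp s A B v) = `[A, B]%classic.
Proof.
apply/seteqP; split => t; rewrite /edom/= in_itv/= /interp;
  by case: ifP; rewrite ?ltxx ?ltNyr.
Qed.

Lemma interp_continuous_pl s A B v : spans s A B ->
  continuous_pl (interp s A B v) A B.
Proof.
move=> sAB; have [As Bs AB sB] := sAB; split => //.
pose l := sort <=%R (undup s).
have ls z : (z \in l) = (z \in s) by rewrite mem_sort mem_undup.
have : sorted <%R l by rewrite sort_lt_sorted undup_uniq.
case lE : l => [|a l'] /=; first by have := ls A; rewrite lE As.
move=> pl; have sl : sorted <=%R l by rewrite sort_le_sorted.
have aA : a = A.
  apply/le_anti/andP; split; last first.
    by have /sB/andP[] : a \in s by rewrite -ls lE mem_head.
  have : A \in l by rewrite ls.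
  rewrite lE inE => /predU1P[->//|Al].
  by have /allP/(_ _ Al) := order_path_min (@lt_trans _ R) pl; exact: ltW.
rewrite aA in lE pl; exists l'; split => // [|i il].
  apply/le_anti/andP; split.
    have /sB/andP[//] : last A l' \in s by rewrite -ls lE mem_last.
  have : B \in l by rewrite ls.
  rewrite lE => /(nthP A)[i il <-]; rewrite (last_nth A).
  have mono := sorted_leq_nth (@le_trans _ R) (@lexx _ R) A sl.
  by rewrite -lE mono ?inE// lE//= -ltnS.
have lAB z : z \in A :: l' -> A <= z <= B by rewrite -lE ls; exact: sB.
have i1 : nth A (A :: l') i \in A :: l' by rewrite mem_nth//= ltnW.
have i2 : nth A l' i \in A :: l' by rewrite inE mem_nth ?orbT.
apply: interp_linear_on => //.
- by have /andP[] := lAB _ i1.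
- have := sorted_leq_nth (@le_trans _ R) (@lexx _ R) A sl.
  by rewrite lE => /(_ i i.+1); apply; rewrite ?inE//= ltnW.
- by have /andP[] := lAB _ i2.
- move=> z zs; have := @sorted_no_between A l i z sl; rewrite ls zs lE/= ltnS.
  by apply.
Qed.

(** Stated for any filter F, to serve both one-sided derivatives. *)
Lemma quotient_affine (F : set_system R) {FF : ProperFilter F} phi
    (y c r : R) :
  phi y = r%:E -> (\forall h \near F, h != 0 /\ phi (y + h) = (c * h + r)%:E) ->
  ((phi (y + h)%R - phi y) * (h^-1)%:E)%E @[h --> F] --> c%:E.
Proof.
move=> phiy near; apply: cvg_near_cst; apply: filterS near => h [h0 ->].
by rewrite phiy -EFinB -EFinM addrK mulfK.
Qed.

Lemma right_derivative_affine phi (y c r e : R) : y < e ->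
  (forall t, y <= t <= e -> phi t = (c * (t - y) + r)%:E) ->
  is_right_derivative phi y c%:E.
Proof.
move=> ye phiE; have phiy : phi y = r%:E.
  by rewrite phiE ?subrr ?mulr0 ?add0r// lexx ltW.
split; first by rewrite phiy.
apply: (quotient_affine phiy); near=> h.
have h0 : 0 < h by near: h; exact: nbhs_right_gt.
have he : h < e - y by near: h; apply: nbhs_right_lt; rewrite subr_gt0.
by rewrite gt_eqF// phiE; [rewrite (addrC y) addrK|lra].
Unshelve. all: by end_near. Qed.

Lemma left_derivative_affine phi (y c r e : R) : e < y ->
  (forall t, e <= t <= y -> phi t = (c * (t - y) + r)%:E) ->
  is_left_derivative phi y c%:E.
Proof.
move=> ye phiE; have phiy : phi y = r%:E.
  by rewrite phiE ?subrr ?mulr0 ?add0r// lexx ltW.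
split; first by rewrite phiy.
apply: (quotient_affine phiy); near=> h.
have h0 : h < 0 by near: h; exact: nbhs_left_lt.
have he : e - y < h by near: h; apply: nbhs_left_gt; rewrite subr_lt0.
by rewrite lt_eqF// phiE; [rewrite (addrC y) addrK|lra].
Unshelve. all: by end_near. Qed.

(** Off the list s the function is affine around y, so both one-sided
    derivatives are the slope of the piece. *)
Lemma knots_interp s A B v : spans s A B ->
  knots (interp s A B v) A B `<=` [set` s].
Proof.
move=> sAB y; have [As Bs AB sB] := sAB.
move=> [->|[->|[/andP[Ay yB] [l [r [[_ yl] [_ yr]] lr]]]]]//=.
apply: contra_notT lr => ys.
have yAB : A <= y <= B by lra.
have [p [q [apq /andP[py yq]]]] := adjacent_around sAB yAB.
have [ps qs pq _] := apq.
have {}py : p < y by rewrite lt_neqAle py andbT; apply: contraNneq ys => <-.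
have {}yq : y < q by rewrite lt_neqAle yq andbT; apply: contraNneq ys => ->.
pose c := (v q - v p) / (q - p).
have phiE t : p <= t <= q ->
    interp s A B v t = (c * (t - y) + chord v p q y)%:E.
  move=> ptq; rewrite (interp_chord _ sAB apq ptq) /chord -/c.
  by congr EFin; ring.
have [_ yr'] : is_right_derivative (interp s A B v) y c%:E.
  by apply: (right_derivative_affine yq) => t ytq; apply: phiE; lra.
have [_ yl'] : is_left_derivative (interp s A B v) y c%:E.
  by apply: (left_derivative_affine py) => t pty; apply: phiE; lra.
rewrite (cvg_unique (@ereal_hausdorff R) yl yl').
by rewrite (cvg_unique (@ereal_hausdorff R) yr yr').
Qed.

(** On the segment between two maximum points, concavity bounds phi from below
    by the maximal value. *)
Lemma concave_max_flat phi (r y z t : R) : concave phi ->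
  (forall u, (phi u <= phi y)%E) -> phi y = r%:E -> phi z = r%:E ->
  (y <= t <= z) || (z <= t <= y) -> phi t = r%:E.
Proof.
move=> cphi ymax phiy phiz tyz; apply/le_anti; rewrite -{1}phiy ymax/=.
have flat a b : a <= t <= b -> phi a = r%:E -> phi b = r%:E -> (r%:E <= phi t)%E.
  move=> /andP[at_ tb] phia phib; move: (le_trans at_ tb).
  rewrite le_eqVlt => /predU1P[ab|ab].
    have -> : t = a by lra.
    by rewrite phia.
  have := @concave_ge_chord _ phi (fun=> r) a b t cphi ab.
  rewrite /chord subrr !mul0r addr0; apply => //.
  by rewrite at_.
by case/orP: tyz => /flat; apply.
Qed.

Lemma flat_right_derivative phi (r y z : R) : concave phi ->
  (forall u, (phi u <= phi y)%E) -> phi y = r%:E -> phi z = r%:E -> y < z ->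
  is_right_derivative phi y 0%E.
Proof.
move=> cphi ymax phiy phiz yz; apply: (right_derivative_affine (r := r) yz).
move=> t tyz; rewrite mul0r add0r.
by apply: (@concave_max_flat _ _ y z) => //; rewrite tyz.
Qed.

Lemma flat_left_derivative phi (r y z : R) : concave phi ->
  (forall u, (phi u <= phi y)%E) -> phi y = r%:E -> phi z = r%:E -> z < y ->
  is_left_derivative phi y 0%E.
Proof.
move=> cphi ymax phiy phiz yz; apply: (left_derivative_affine (r := r) yz).
move=> t tyz; rewrite mul0r add0r.
by apply: (@concave_max_flat _ _ y z) => //; rewrite tyz orbT.
Qed.

End Structure.

(** * The three estimators for a sample without ties *)

Section Samples.
Context {R : realType} (n : nat) (x : 'I_n -> R).
Implicit Types (s : seq R) (m z : R).

Lemma size_ostats : size (ostats x) = n.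
Proof. by rewrite size_sort size_codom card_ord. Qed.

Lemma mem_ostats z : (z \in ostats x) = (z \in codom x).
Proof. exact: mem_sort. Qed.

Lemma sorted_ostats : sorted <=%R (ostats x).
Proof. exact: sort_le_sorted. Qed.

(** Two different members prevent the extreme members from coinciding. *)
Lemma spans_sorted s (a b : R) : sorted <=%R s -> a \in s -> b \in s -> a != b ->
  spans s (item s 1) (item s (size s)).
Proof.
move=> ss sa sb ab; rewrite /item/=.
have s0 : (0 < size s)%N by case: (s) sa.
have s1 : ((size s).-1 < size s)%N by rewrite prednK.
have mono := sorted_leq_nth (@le_trans _ R) (@lexx _ R) 0 ss.
have sB z : z \in s -> nth 0 s 0 <= z <= nth 0 s (size s).-1.
  move=> /(nthP 0)[i il <-]; rewrite !mono ?inE//.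
  by rewrite -ltnS prednK.
split => //; try exact: mem_nth.
move: ab; have /andP[ha hb] := sB _ sa.
rewrite lt_neqAle (le_trans ha hb) andbT.
apply: contra => /eqP e; have := sB _ sa; have := sB _ sb; rewrite e.
by rewrite -!eq_le => /eqP <- /eqP <-.
Qed.

Lemma mem_mode_augmented m z :
  (z \in mode_augmented m x) = (z == m) || (z \in codom x).
Proof.
rewrite /mode_augmented; case: ifPn => ms.
  by rewrite -mem_ostats; case: eqVneq => // ->; rewrite ms.
rewrite mem_cat inE orbCA -mem_cat cat_take_drop mem_ostats.
by [].
Qed.

(** In a sorted list, the first count (< m) members are those below m. *)
Lemma sorted_mode_augmented m : sorted <=%R (mode_augmented m x).
Proof.
rewrite /mode_augmented; case: ifPn => ms; first exact: sorted_ostats.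
have ss := sorted_ostats.
rewrite -sorted_filter_lt//.
have -> : drop (count (fun y => y < m) (ostats x)) (ostats x) =
    [seq z <- ostats x | m <= z].
  by rewrite sorted_filter_ge.
rewrite -[_ :: _]cat1s sorted_pairwise; last exact: le_trans.
rewrite !pairwise_cat -!sorted_pairwise ?le_sorted_filter//=; try exact: le_trans.
rewrite allrel1l andbT; apply/andP; split.
- apply/allrelP => a b; rewrite mem_filter inE => /andP[am _] /predU1P[->|].
    exact: ltW.
  by rewrite mem_filter => /andP[mb _]; exact: le_trans (ltW am) mb.
- by apply/allP => b; rewrite mem_filter => /andP[].
Qed.

Lemma size_mode_augmented m : size (mode_augmented m x) =
  if m \in codom x then n else n.+1.
Proof.
rewrite /mode_augmented mem_ostats; case: ifP => _; first exact: size_ostats.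
by rewrite size_cat/= addnS -size_cat cat_take_drop size_ostats.
Qed.

Lemma mem_signed_ostats z : (z \in signed_ostats x) =
  (z == 0) || (`|z| \in codom (abs_sample x)).
Proof.
rewrite mem_cat inE map_rev mem_rev.
have abs_ostats y : (y \in ostats (abs_sample x)) = (y \in codom (abs_sample x)).
  exact: mem_sort.
have nn y : y \in codom (abs_sample x) -> 0 <= y.
  by move=> /codomP[i ->]; exact: normr_ge0.
have neg y : y < 0 -> (y \in codom (abs_sample x)) = false.
  by move=> y0; apply/negP => /nn; rewrite leNgt y0.
rewrite abs_ostats -{1}[z]opprK mem_map; last exact: oppr_inj.
rewrite abs_ostats; case: (ltgtP z 0) => z0; rewrite ?orbT//=.
- by rewrite (neg z)// orbF ltr0_norm.
- by rewrite (neg (- z)) ?oppr_lt0// gtr0_norm.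
Qed.

(** When both end values are finite, phi z is at least a convex combination of
    them; an end value -oo is below everything. *)
Lemma concave_ge_min (phi : R -> \bar R) (a b z : R) : concave phi ->
  (forall t, phi t < +oo)%E -> a < b -> a <= z <= b ->
  (phi a <= phi z)%E \/ (phi b <= phi z)%E.
Proof.
move=> cphi phioo ab azb.
case phia : (phi a) => [ra| |];
  [|by have := phioo a; rewrite phia|by left; rewrite leNye].
case phib : (phi b) => [rb| |];
  [|by have := phioo b; rewrite phib|by right; rewrite leNye].
pose v t := if t == a then ra else rb.
have va : phi a = (v a)%:E by rewrite /v eqxx.
have vb : phi b = (v b)%:E by rewrite /v gt_eqF.
have := concave_ge_chord cphi ab azb va vb.
have [l l01 [_ ->]] := chord_conv ab azb; rewrite /v eqxx gt_eqF//.
have [rab|rba] := leP ra rb => /(le_trans _) h; [left|right]; apply: h;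
  by rewrite lee_fin; nra.
Qed.

(** Here anchor holds because both ends of the range of the data are
    observations, and a concave function on a segment is at least its smaller
    end value. *)
Lemma mle_unconstrained : injective x -> (2 <= n)%N ->
  (exists! phi, is_argmax classC (Psi x) phi) /\
  forall phi, is_argmax classC (Psi x) phi ->
    (forall j, (1 <= j < n)%N ->
       linear_on phi (item (ostats x) j) (item (ostats x) j.+1)) /\
    (forall y, ~ (item (ostats x) 1 <= y <= item (ostats x) n) ->
       phi y = -oo%E /\ expeR (phi y) = 0%E).
Proof.
move=> injx n2; have n0 : (0 < n)%N by exact: ltnW.
set A := item _ 1; set B := item _ n.
have xs i : x i \in ostats x by rewrite mem_ostats codom_f.
have sAB : spans (ostats x) A B.
  have := spans_sorted sorted_ostats (xs (Ordinal n0)) (xs (Ordinal n2)).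
  by rewrite (inj_eq injx) size_ostats; exact.
have classE : @classC R = order_class (fun _ _ => False).
  by apply/seteqP; split => phi; [move=> ?; split|case].
have compat v : admissible (ostats x) (fun _ _ => False) v ->
    forall a b, False -> (interp (ostats x) A B v a <= interp (ostats x) A B v b)%E.
  by [].
have anchor phi : order_class (fun _ _ => False) phi ->
    forall z, z \in ostats x -> exists i, (phi (x i) <= phi z)%E.
  move=> [[phioo _ cphi _] _] z zs; have [As Bs AB /(_ _ zs) zAB] := sAB.
  move: As Bs; rewrite !mem_ostats => /codomP[i Ai] /codomP[j Bj].
  have [h|h] := concave_ge_min cphi phioo AB zAB.
    by exists i; rewrite -Ai.
  by exists j; rewrite -Bj.
rewrite classE; split; first exact: (argmax_exists_uniq sAB xs n0 compat anchor).
move=> phi /(argmax_interp sAB xs n0 compat anchor)[v av ->]; split.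
  move=> j /andP[j1 jn].
  have js : (j.-1.+1 < size (ostats x))%N by rewrite prednK// size_ostats.
  have mono := sorted_leq_nth (@le_trans _ R) (@lexx _ R) 0 sorted_ostats.
  have [_ _ _ sB] := sAB; rewrite /item/= -[in nth 0 _ j](prednK j1).
  apply: interp_linear_on => //.
  - by have /sB/andP[] := mem_nth 0 (ltnW js).
  - by rewrite mono ?inE// ltnW.
  - by have /sB/andP[] := mem_nth 0 js.
  - by move=> z; exact: sorted_no_between sorted_ostats js.
by move=> y /interp_out ->.
Qed.

(** Here anchor holds because a knot is an observation or the mode m, where phi
    is largest.  For the derivative, phi attains its maximum phi m at some
    observation as well, and it is constant in between. *)
Lemma mle_mode m : injective x ->
  let Zs := mode_augmented m x in
  let Z1 := item Zs 1 in let ZN := item Zs (size Zs) in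
  (2 <= size Zs)%N ->
  (exists! phi, is_argmax (classCm m) (Psi x) phi) /\
  forall phi, is_argmax (classCm m) (Psi x) phi ->
    [/\ edom phi = `[Z1, ZN]%classic, continuous_pl phi Z1 ZN,
        knots phi Z1 ZN `<=` [set` Zs] &
        (forall i, x i <> m) ->
          is_right_derivative phi m 0%E \/ is_left_derivative phi m 0%E].
Proof.
move=> injx Zs A B N2.
have xs i : x i \in Zs by rewrite mem_mode_augmented codom_f orbT.
have ms : m \in Zs by rewrite mem_mode_augmented eqxx.
have [n0 [i xim]] : (0 < n)%N /\ exists i, x i != m.
  move: N2; rewrite size_mode_augmented; case: ifPn => [mx n2|mx].
    have n0 : (0 < n)%N by exact: ltnW.
    split=> //; have [e|] := eqVneq (x (Ordinal n0)) m; last by exists (Ordinal n0).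
    by exists (Ordinal n2); rewrite -e (inj_eq injx).
  rewrite ltnS => n0; split=> //; exists (Ordinal n0).
  by apply: contraNneq mx => <-; exact: codom_f.
have sAB : spans Zs A B.
  exact: spans_sorted (sorted_mode_augmented m) (xs i) ms xim.
pose rel (_ b : R) := b = m.
have classE : classCm m = order_class rel.
  apply/seteqP; split => phi [cphi h]; split => //.
    by move=> a b ->.
  by move=> t; exact: h.
have compat v : admissible Zs rel v -> forall a b, rel a b ->
    (interp Zs A B v a <= interp Zs A B v b)%E.
  move=> [_ rv] a b ->; rewrite (interp_knot _ sAB ms).
  by apply: interp_ub => // z zs; exact: rv.
have anchor phi : order_class rel phi ->
    forall z, z \in Zs -> exists i, (phi (x i) <= phi z)%E.
  move=> [_ rphi] z; rewrite mem_mode_augmented => /predU1P[->|/codomP[j ->]].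
    by exists i; exact: rphi.
  by exists j.
rewrite classE; split; first exact: (argmax_exists_uniq sAB xs n0 compat anchor).
move=> phi mphi.
have [k phik] := argmax_le_data sAB xs n0 compat anchor mphi.
have [[[phioo _ cphi _] rphi] _] := mphi.
have [v av phiE] := argmax_interp sAB xs n0 compat anchor mphi.
split.
- by rewrite phiE edom_interp.
- by rewrite phiE; exact: interp_continuous_pl.
- by rewrite phiE; exact: knots_interp.
- move=> /(_ k) xkm; have ymax t : (phi t <= phi m)%E by exact: rphi.
  have phim : phi m = (v m)%:E by rewrite phiE (interp_knot _ sAB).
  have phixk : phi (x k) = (v m)%:E.
    by rewrite -phim; apply/le_anti; rewrite ymax phik.
  have [mk|km|mk] := ltgtP m (x k); last by case: xkm.
    by left; exact: flat_right_derivative phim phixk mk.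
  by right; exact: flat_left_derivative phim phixk km.
Qed.

Lemma adjacent_opp s p q : (forall z, z \in s -> - z \in s) ->
  adjacent s p q -> adjacent s (- q) (- p).
Proof.
move=> sym [ps qs pq adj]; split; rewrite ?sym// ?ltrN2// => z /sym/adj.
by case; [rewrite lerNl; right|rewrite lerNr; left].
Qed.

Lemma interp_opp s (B : R) (v : R -> R) t : spans s (- B) B ->
  (forall z, z \in s -> - z \in s) -> (forall z, z \in s -> v (- z) = v z) ->
  interp s (- B) B v (- t) = interp s (- B) B v t.
Proof.
move=> sB sym vsym; rewrite /interp lerN2 lerNl andbC; case: ifP => // tB.
have [p [q [apq ptq]]] := adjacent_around sB tB; have [ps qs pq _] := apq.
rewrite (plinE _ apq ptq) (plinE _ (adjacent_opp sym apq)); last by lra.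
by congr EFin; rewrite /chord !vsym//; field; lra.
Qed.

(** As phi is even and attains its maximum phi 0 at an observation x k, it does
    so at - x k too, and it is constant on the interval between them, which
    contains 0 in its interior. *)
Lemma mle_symmetric : (forall i, x i != 0) -> (1 <= n)%N ->
  let B := item (ostats (abs_sample x)) n in
  (exists! psi, is_argmax classSC0 (Psi x) psi) /\
  forall psi, is_argmax classSC0 (Psi x) psi ->
    [/\ continuous_pl psi (- B) B,
        knots psi (- B) B `<=` [set` signed_ostats x],
        (forall y, ~ (- B <= y <= B) -> psi y = -oo%E) &
        is_right_derivative psi 0 0%E /\ is_left_derivative psi 0 0%E].
Proof.
move=> x0 n0 B; set s := signed_ostats x.
have xs i : x i \in s.
  by rewrite mem_signed_ostats; apply/orP; right; exact: codom_f.
have sym z : z \in s -> - z \in s.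
  by rewrite !mem_signed_ostats oppr_eq0 normrN.
have s0 : 0 \in s by rewrite mem_signed_ostats eqxx.
have Bs : B \in codom (abs_sample x).
  have -> : (B \in codom (abs_sample x)) = (B \in ostats (abs_sample x)).
    by rewrite [in RHS]mem_sort.
  by apply: mem_nth; rewrite size_sort size_codom card_ord prednK.
have xB i : `|x i| <= B.
  have : `|x i| \in ostats (abs_sample x) by rewrite mem_sort; exact: codom_f.
  have so : sorted <=%R (ostats (abs_sample x)) by exact: sort_le_sorted.
  have mono := sorted_leq_nth (@le_trans _ R) (@lexx _ R) 0 so.
  have szo : size (ostats (abs_sample x)) = n by rewrite size_sort size_codom card_ord.
  move=> /(nthP 0)[k]; rewrite szo => kn <-.
  by rewrite /B /item mono ?inE ?szo ?prednK// -ltnS prednK.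
have B0 : 0 < B.
  by apply: lt_le_trans (xB (Ordinal n0)); rewrite normr_gt0.
have sAB : spans s (- B) B.
  have Bs' : B \in s by rewrite mem_signed_ostats (gtr0_norm B0) Bs orbT.
  split => //; [exact: sym|lra|move=> z].
  rewrite mem_signed_ostats => /predU1P[->|/codomP[i zi]]; first by lra.
  by rewrite -ler_norml zi; exact: xB.
pose rel (a b : R) := b = 0 \/ b = - a.
have classE : classSC0 = order_class rel.
  apply/seteqP; split => phi.
    move=> [[cphi h] sphi]; split => // a b [->|->]; first exact: h.
    by rewrite sphi.
  move=> [cphi h]; split; first by split => // t; apply: h; left.
  move=> t; apply/le_anti/andP; split; apply: h; right; by rewrite ?opprK.
have compat v : admissible s rel v -> forall a b, rel a b ->
    (interp s (- B)%R B v a <= interp s (- B)%R B v b)%E.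
  move=> [_ rv] a b [->|->].
    rewrite (interp_knot _ sAB s0).
    by apply: interp_ub => // z zs; apply: rv => //; left.
  rewrite interp_opp// => z zs; apply/le_anti/andP; split; apply: rv => //;
    by [exact: sym|right; rewrite ?opprK].
have anchor phi : order_class rel phi ->
    forall z, z \in s -> exists i, (phi (x i) <= phi z)%E.
  move=> [_ rphi] z; rewrite mem_signed_ostats => /predU1P[->|/codomP[i]].
    by exists (Ordinal n0); apply: rphi; left.
  move=> /eqP; rewrite /abs_sample eqr_norm2 => /orP[/eqP ->|/eqP ->]; exists i => //.
  by apply: rphi; right.
rewrite classE; split; first exact: (argmax_exists_uniq sAB xs n0 compat anchor).
move=> phi mphi.
have [k phik] := argmax_le_data sAB xs n0 compat anchor mphi.
have [[[phioo _ cphi _] rphi] _] := mphi.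
have [v av phiE] := argmax_interp sAB xs n0 compat anchor mphi.
have ymax t : (phi t <= phi 0%R)%E by apply: rphi; left.
have phi0 : phi 0 = (v 0)%:E by rewrite phiE (interp_knot _ sAB).
have phixk : phi (x k) = (v 0)%:E.
  by rewrite -phi0; apply/le_anti; rewrite ymax phik.
have phiNxk : phi (- x k) = (v 0)%:E.
  by apply/le_anti; rewrite -{1}phi0 ymax -phixk/=; apply: rphi; right.
split.
- by rewrite phiE; exact: interp_continuous_pl.
- by rewrite phiE; exact: knots_interp.
- by move=> y; rewrite phiE; exact: interp_out.
- have := x0 k; rewrite neq_lt => /orP[xk|xk]; split.
  + apply: (flat_right_derivative cphi ymax phi0 phiNxk); lra.
  + exact: (flat_left_derivative cphi ymax phi0 phixk).
  + exact: (flat_right_derivative cphi ymax phi0 phixk).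
  + apply: (flat_left_derivative cphi ymax phi0 phiNxk); lra.
Qed.

End Samples.

(** * Absence of ties *)

Section Sampling.
Context d (T : measurableType d) (R : realType) (P : probability T R).
Implicit Types (X : {RV P >-> R}).

Lemma has_density_set1 X f c : has_density X f -> distribution P X [set c] = 0%E.
Proof. by move=> ->; rewrite ?integral_set1//; exact: measurable_set1. Qed.

Lemma ae_neq_cst X f c : has_density X f -> {ae P, forall w, X w <> c}.
Proof.
move=> Xf; exists (X @^-1` [set c]); split.
- by apply: measurable_funPTI; exact: measurable_set1.
- exact: has_density_set1 Xf.
- by move=> w /= /contrapT.
Qed.

(** By independence the joint law of X i and X j is the product of their laws,
    and by Fubini the diagonal has measure 0, its sections being points. *)
Lemma ae_neq_independent n (X : 'I_n -> {RV P >-> R}) f i j : i != j ->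
  mutually_independent X -> has_density (X j) f ->
  {ae P, forall w, X i w <> X j w}.
Proof.
move=> ij indX Xjf.
pose Zf w := (X i w, X j w).
have mZ : measurable_fun setT Zf by exact: measurable_fun_pair.
pose Z : {mfun T >-> (R * R)%type} :=
  HB.pack Zf (isMeasurableFun.Build _ _ _ _ Zf mZ).
pose diag := [set xy : R * R | xy.1 - xy.2 = 0].
have mdiag : measurable diag.
  have mB : measurable_fun [set: R * R] (fun xy : R * R => xy.1 - xy.2).
    by apply: measurable_funB.
  by rewrite -[diag]setTI; exact: (mB measurableT _ (measurable_set1 0)).
have rect A B : measurable A -> measurable B ->
    distribution P Z (A `*` B) =
    (distribution P (X i) A * distribution P (X j) B)%E.
  move=> mA mB.
  (* The product rule for the pair is the one for all n variables with the whole
     line in the other coordinates. *)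
  pose C k : set R := if k == i then A else if k == j then B else setT.
  have mC k : measurable (C k) by rewrite /C; case: (k == i); case: (k == j).
  have := indX C mC.
  rewrite (bigD1 i)//= (bigD1 j)//=; last by rewrite eq_sym.
  rewrite big1; last first.
    move=> k /andP[ki kj]; rewrite /C (negbTE ki) (negbTE kj) preimage_setT.
    exact: probability_setT.
  rewrite mule1 /C eqxx eq_sym (negbTE ij) eqxx /distribution /pushforward => <-.
  congr (P _); apply/seteqP; split => w /=.
    by move=> [Aw Bw] k _; case: eqP => [->|_] //; case: eqP => [->|_] //.
  move=> H; split; first by have := H i I; rewrite eqxx.
  by have := H j I; rewrite eq_sym (negbTE ij) eqxx.
have diag0 : distribution P Z diag = 0%E.
  rewrite -(product_measure_unique rect mdiag)/= /product_measure1.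
  rewrite integral0_eq// => y _ /=.
  rewrite (_ : xsection diag y = [set y]) ?(has_density_set1 _ Xjf)//.
  apply/seteqP; split => z; rewrite /xsection /diag /= inE/=.
    by move/eqP; rewrite subr_eq0 => /eqP.
  by move=> ->; rewrite subrr.
exists (Z @^-1` diag); split => //.
  by rewrite -[X in measurable X]setTI; exact: (mZ measurableT diag mdiag).
by move=> w /= /contrapT e; rewrite /diag /= e subrr.
Qed.

End Sampling.

Theorem theorem2p1 (R : realType) (d : measure_display) (T : measurableType d)
    (P : probability T R) (n : nat) (X : 'I_n -> {RV P >-> R}) (f : R -> R)
    (m : R) (iidX : iid_density X f) :
  {ae P, forall w : T,
    let x : 'I_n -> R := fun i => X i w in
    let Xo := item (ostats x) in
    let Zs := mode_augmented m x in
    let N := size Zs in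
    let Z := item Zs in
    let absX := item (ostats (abs_sample x)) in
    [/\
      (2 <= n)%N ->
        (exists! phi, is_argmax classC (Psi x) phi) /\
        forall phi, is_argmax classC (Psi x) phi ->
          (forall j, (1 <= j < n)%N -> linear_on phi (Xo j) (Xo j.+1)) /\
          (forall y, ~ (Xo 1%N <= y <= Xo n) ->
             phi y = -oo%E /\ expeR (phi y) = 0%E),
      (2 <= N)%N ->
        (exists! phi, is_argmax (classCm m) (Psi x) phi) /\
        forall phi, is_argmax (classCm m) (Psi x) phi ->
          [/\ edom phi = `[Z 1%N, Z N]%classic,
              continuous_pl phi (Z 1%N) (Z N),
              knots phi (Z 1%N) (Z N) `<=` [set` Zs] &
              (forall i, x i <> m) ->
                is_right_derivative phi m 0%E \/ is_left_derivative phi m 0%E]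
    & (1 <= n)%N ->
        (exists! psi, is_argmax classSC0 (Psi x) psi) /\
        forall psi, is_argmax classSC0 (Psi x) psi ->
          [/\ continuous_pl psi (- absX n) (absX n),
              knots psi (- absX n) (absX n) `<=` [set` signed_ostats x],
              (forall y, ~ (- absX n <= y <= absX n) -> psi y = -oo%E) &
              is_right_derivative psi 0 0%E /\ is_left_derivative psi 0 0%E]]}.
Proof.
have [_ indX denX] := iidX.
have ae_inj : {ae P, forall w, forall i j, i != j -> X i w <> X j w}.
  apply: filter_forall => i; apply: filter_forall => j.
  have [->|ij] := eqVneq i j; first by apply: aeW.
  apply: filterS (ae_neq_independent ij indX (denX j)) => w Xij _.
  exact: Xij.
have ae_neq0 : {ae P, forall w, forall i, X i w <> 0}.
  by apply: filter_forall => i; exact: ae_neq_cst (denX i).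
apply: filterS2 ae_inj ae_neq0 => w inj neq0.
have injx : injective (fun i => X i w).
  by move=> i j e; apply/eqP/negP => /negP ij; exact: (inj i j ij e).
split.
- exact: mle_unconstrained.
- exact: mle_mode.
- by apply: mle_symmetric => i; apply/eqP; exact: neq0.
Qed.
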